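(* Let $G$ be a group of type $\mathrm{FP}(\mathbb{Q})$ with $\mathrm{cd}_{\mathbb{Q}}(G) = d$, let $N$ be a normal subgroup of $G$ such that $G/N$ is nilpotent, and let $\chi = (\chi_1, \dots, \chi_n)$ be a multicharacter on $G/N$. If $$H^d\big(G; \widehat{\mathbb{Q}G}^{(\pm\chi_1, \dots, \pm\chi_n)}\big) = 0$$ for all $2^n$ choices of signs, then $\mathrm{cd}_{\mathbb{Q}}(N) < \mathrm{cd}_{\mathbb{Q}}(G)$.
   Context: $\mathrm{cd}_{\mathbb{Q}}(G)=\sup\{n : H^n(G;M)\neq 0 \text{ for some } \mathbb{Q}G\text{-module } M\}$. $G$ is of type $\mathrm{FP}(\mathbb{Q})$ if the trivial $\mathbb{Q}G$-module $\mathbb{Q}$ has a finite-length resolution by finitely generated projective $\mathbb{Q}G$-modules. Crossed products. For a ring $R$ and a group $\Gamma$, a crossed product $R*\Gamma$ is a $\Gamma$-graded ring $\bigoplus_{\gamma\in\Gamma}R_\gamma$ ($R_\gamma R_\delta\subseteq R_{\gamma\delta}$) with $R_e=R$ and such that each $R_\gamma$ contains a unit $u_\gamma$; every element is uniquely a finite sum $\sum_\gamma r_\gamma u_\gamma$ with $r_\gamma\in R$. If $1\to N\to G\to Q\to 1$ is exact with a chosen set-theoretic section $s\colon Q\to G$, then $RG=(RN)*Q$ with $u_q=s(q)$. Novikov rings. For a homomorphism $\chi\colon\Gamma\to\mathbb{R}$, $\widehat{R*\Gamma}^{\chi}$ is the ring of formal series $x=\sum_{\gamma\in\Gamma} r_\gamma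 u_\gamma$ ($r_\gamma\in R$) such that $\{\gamma : r_\gamma\neq0,\ \chi(\gamma)\leqslant t\}$ is finite for every $t\in\mathbb{R}$, with multiplication extending that of $R*\Gamma$. Multicharacters. A central series of a nilpotent group $Q$ is a series $1=Q_n\leqslant\cdots\leqslant Q_0=Q$ of normal subgroups with $Q_{i-1}/Q_i\leqslant Z(Q/Q_i)$ for $1\leqslant i\leqslant n$. A multicharacter on $Q$ is a list $\chi=(\chi_1,\dots,\chi_n)$ of homomorphisms $\chi_i\colon Q_{i-1}/Q_i\to\mathbb{R}$ for some central series of $Q$. Given a crossed product $R*Q$, define recursively rings $R_n=R, R_{n-1},\dots,R_0$ and crossed products $R_i*(Q/Q_i)$ containing $R*Q$: given $R_i*(Q/Q_i)$, let $R_{i-1}=\widehat{R_i*(Q_{i-1}/Q_i)}^{\chi_i}$; since $Q_{i-1}/Q_i$ is central in $Q/Q_i$, conjugation by the units $u_q$ preserves $R_{i-1}$ and the multiplication of $R_i*(Q/Q_i)=(R_i*(Q_{i-1}/Q_i))*(Q/Q_{i-1})$ extends to a crossed product $R_{i-1}*(Q/Q_{i-1})$. Then $\widehat{R*Q}^{\chi}:=R_0$. For $G$ with nilpotent quotient $Q=G/N$ and a multicharacter $\chi$ on $Q$, $\widehat{RG}^{\chi}:=\widehat{(RN)*Q}^{\chi}$, a ring containing $RG$. *)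

(* Defs.v *)
From HB Require Import structures.
From mathcomp Require Import all_boot all_order all_algebra.
From mathcomp Require Import generic_quotient finmap lra.
From mathcomp Require Import all_classical reals ereal.

Set Implicit Arguments.
Unset Strict Implicit.
Unset Printing Implicit Defensive.

Import Order.TTheory GRing.Theory Num.Theory.
Local Open Scope classical_set_scope.
Local Open Scope ring_scope.
Local Open Scope quotient_scope.

Record normalSubgroup (G : groupType) := NormalSubgroup {
  ns_pred :> {pred G};
  ns_closed : group_closed ns_pred;
  ns_conj : forall x y : G, x \in ns_pred -> (x ^ y)%g \in ns_pred }.

Section NormalSubgroups.
Variables (G : groupType) (N : normalSubgroup G).
Implicit Types x y : G.

Lemma ns1 : 1%g \in ns_pred N. Proof. exact: (ns_closed N).1. Qed.
Lemma nsV x : x \in ns_pred N -> (x^-1)%g \in ns_pred N.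
Proof. exact: (group_closedV (ns_closed N)). Qed.
Lemma nsM x y : x \in ns_pred N -> y \in ns_pred N -> (x * y)%g \in ns_pred N.
Proof. exact: (group_closedM (ns_closed N)). Qed.

Definition subgroup_of : Type := {x : G | x \in ns_pred N}.
HB.instance Definition _ := SubChoice.on subgroup_of.
HB.instance Definition _ :=
  SubChoice_isSubGroup.Build G (ns_pred N) subgroup_of (ns_closed N).

Definition coset_rel : rel G := fun x y => (x^-1 * y)%g \in ns_pred N.

Fact coset_rel_refl : reflexive coset_rel.
Proof. by move=> x; rewrite /coset_rel mulVg ns1. Qed.
Fact coset_rel_sym : symmetric coset_rel.
Proof.
by move=> x y; rewrite /coset_rel; apply/idP/idP => /nsV;
  rewrite invgM invgK.
Qed.
Fact coset_rel_trans : transitive coset_rel.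
Proof.
move=> y x z; rewrite /coset_rel => xy yz.
by have := nsM xy yz; rewrite mulgA -(mulgA _ y) mulgV mulg1.
Qed.

Canonical coset_equiv :=
  EquivRel coset_rel coset_rel_refl coset_rel_sym coset_rel_trans.

Definition quotient_by : Type := {eq_quot coset_equiv}.
HB.instance Definition _ := Choice.on quotient_by.

Definition qproj x : quotient_by := \pi_({eq_quot coset_equiv}) x.
Definition lift_of (q : quotient_by) : G :=
  repr (q : {eq_quot coset_equiv}).

Lemma lift_ofK : cancel lift_of qproj.
Proof. exact: reprK. Qed.

Lemma qprojP x y : (qproj x = qproj y) <-> (x^-1 * y)%g \in ns_pred N.
Proof. by split=> [/eqmodP//|xy]; apply/eqmodP. Qed.

Lemma lift_of_qproj x : exists2 k, k \in ns_pred N & lift_of (qproj x) = (x * k)%g.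
Proof.
exists (x^-1 * lift_of (qproj x))%g; last by rewrite mulVKg.
by apply/qprojP; rewrite lift_ofK.
Qed.

Definition qmul (a b : quotient_by) := qproj (lift_of a * lift_of b)%g.
Definition qinv (a : quotient_by) := qproj (lift_of a)^-1%g.

Lemma qproj_qmul x y : qproj (x * y)%g = qmul (qproj x) (qproj y).
Proof.
rewrite /qmul; have [k Nk ->] := lift_of_qproj x; have [l Nl ->] := lift_of_qproj y.
apply/qprojP; rewrite invgM.
have -> : (y^-1 * x^-1 * (x * k * (y * l)) = k ^ y * l)%g.
  by rewrite /conjg !mulgA -(mulgA y^-1 x^-1 x)%g mulVg mulg1.
by apply: nsM => //; apply: ns_conj.
Qed.

Fact qmulA : associative qmul.
Proof.
move=> a b c; rewrite -(lift_ofK a) -(lift_ofK b) -(lift_ofK c).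
by rewrite -!qproj_qmul mulgA.
Qed.
Fact qmul1 : left_id (qproj 1%g) qmul.
Proof. by move=> a; rewrite -(lift_ofK a) -qproj_qmul mul1g. Qed.
Fact qmulg1 : right_id (qproj 1%g) qmul.
Proof. by move=> a; rewrite -(lift_ofK a) -qproj_qmul mulg1. Qed.
Fact qmulV : left_inverse (qproj 1%g) qinv qmul.
Proof. by move=> a; rewrite -{2}(lift_ofK a) /qinv -qproj_qmul mulVg. Qed.
Fact qmulgV : right_inverse (qproj 1%g) qinv qmul.
Proof. by move=> a; rewrite -{1}(lift_ofK a) /qinv -qproj_qmul mulgV. Qed.

HB.instance Definition _ :=
  isGroup.Build quotient_by qmulA qmul1 qmulg1 qmulV qmulgV.

Lemma qprojM : {morph qproj : x y / (x * y)%g}.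
Proof. exact: qproj_qmul. Qed.

Lemma qproj_surj (q : quotient_by) : exists x, qproj x = q.
Proof. by exists (lift_of q); rewrite lift_ofK. Qed.

Lemma qproj_eq1 x : (qproj x = 1%g) <-> x \in ns_pred N.
Proof.
split=> [/esym/qprojP|Nx]; first by rewrite invg1 mul1g.
by apply/esym/qprojP; rewrite invg1 mul1g.
Qed.

End NormalSubgroups.

(* [L / H] as a normal subgroup of [G / H]: the image of [L]. *)
Section QuotientSubgroup.
Variables (G : groupType) (H L : normalSubgroup G).

Definition quo_pred : {pred quotient_by H} :=
  fun q => `[< exists2 l, l \in L & qproj H l = q >].

Lemma quo_predP q : reflect (exists2 l, l \in L & qproj H l = q) (q \in quo_pred).
Proof. exact: asboolP. Qed.

Fact quo_closed : group_closed quo_pred.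
Proof.
split; first by apply/quo_predP; exists 1%g; [exact: ns1|].
move=> _ _ /quo_predP[l Ll <-] /quo_predP[m Lm <-]; apply/quo_predP.
exists (l * m^-1)%g; first by apply: nsM => //; apply: nsV.
rewrite qprojM; congr (_ * _)%g; apply: (mulgI (qproj H m)).
by rewrite -qprojM !mulgV.
Qed.

Fact quo_conj x y : x \in quo_pred -> (x ^ y)%g \in quo_pred.
Proof.
move=> /quo_predP[l Ll <-]; have [z <-] := qproj_surj y; apply/quo_predP.
exists (l ^ z)%g; first exact: ns_conj.
rewrite /conjg !qprojM; congr (_ * _)%g; apply: (mulgI (qproj H z)).
by rewrite -qprojM !mulgV.
Qed.

Definition quo_subgroup := NormalSubgroup quo_closed quo_conj.

End QuotientSubgroup.

(* Rings of formal series [sum_g x_g] with [x_g] in a prescribed additive     *)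
(* subgroup [A_g] of a ring [A] and support in a prescribed family of subsets *)
(* of a group.                                                                *)

Record homogeneousPieces (Gam : groupType) (A : pzRingType) :=
  HomogeneousPieces {
  hp_set :> Gam -> set A;
  hp_0 : forall g, hp_set g 0;
  hp_B : forall g x y, hp_set g x -> hp_set g y -> hp_set g (x - y);
  hp_M : forall g h x y, hp_set g x -> hp_set h y -> hp_set (g * h)%g (x * y);
  hp_1 : hp_set 1%g 1 }.

(* The closure properties making convolution of series well defined. *)
Record supportFamily (Gam : groupType) := SupportFamily {
  sf_set :> set Gam -> Prop;
  sf_sub : forall S T : set Gam, S `<=` T -> sf_set T -> sf_set S;
  sf_U : forall S T, sf_set S -> sf_set T -> sf_set (S `|` T);
  sf_M : forall S T, sf_set S -> sf_set T ->
    sf_set [set g | exists2 s, S s & T (s^-1 * g)%g];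
  sf_fin : forall S T, sf_set S -> sf_set T ->
    forall g, finite_set [set s | S s /\ T (s^-1 * g)%g];
  sf_finite : forall S, finite_set S -> sf_set S }.

Definition convolution (Gam : groupType) (A : pzRingType) (x y : Gam -> A) :
    Gam -> A :=
  fun g => \sum_(a \in [set: Gam]) x a * y (a^-1 * g)%g.

Lemma sum_on (I : choiceType) (A : zmodType) (F : I -> A) (X : set I) :
  finite_set X -> (forall i, F i != 0 -> X i) ->
  \sum_(i \in [set: I]) F i = \sum_(i <- fset_set X) F i.
Proof.
move=> finX FX; rewrite -fsbig_finite//; apply/esym/fsbig_widen => // i [_ nX] /=.
by apply: contra_notP nX => /eqP/FX.
Qed.

Section FiniteSums.
Variables (I : choiceType) (A : pzRingType).
Implicit Types (F H : I -> A) (X : set I).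

Lemma sum_mull F a : finite_set [set i | F i != 0] ->
  (\sum_(i \in [set: I]) F i) * a = \sum_(i \in [set: I]) F i * a.
Proof.
move=> fin; rewrite (sum_on fin)// mulr_suml -(sum_on fin)//= => i.
by apply: contra => /eqP->; rewrite mul0r.
Qed.

Lemma sum_mulr F a : finite_set [set i | F i != 0] ->
  a * (\sum_(i \in [set: I]) F i) = \sum_(i \in [set: I]) a * F i.
Proof.
move=> fin; rewrite (sum_on fin)// mulr_sumr -(sum_on fin)//= => i.
by apply: contra => /eqP->; rewrite mulr0.
Qed.

Lemma sum_single F i : (forall j, j != i -> F j = 0) ->
  \sum_(j \in [set: I]) F j = F i.
Proof.
move=> F0; rewrite (@sum_on _ _ _ [set i]) ?fset_set1 ?big_seq_fset1//.
by move=> j; apply: contra_neqP => /eqP/F0.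
Qed.

Lemma sum_neq0 F : \sum_(i \in [set: I]) F i != 0 -> exists i, F i != 0.
Proof.
apply: contra_neqP => F0; apply: fsbig1 => i _.
by apply: contrapT => /eqP Fi; apply: F0; exists i.
Qed.

Lemma sum_add F H : finite_set [set i | F i != 0] ->
  finite_set [set i | H i != 0] ->
  \sum_(i \in [set: I]) (F i + H i) =
  \sum_(i \in [set: I]) F i + \sum_(i \in [set: I]) H i.
Proof.
move=> finF finH; pose X := [set i | F i != 0] `|` [set i | H i != 0].
have finX : finite_set X by rewrite finite_setU.
have XF i : F i != 0 -> X i by left.
have XH i : H i != 0 -> X i by right.
have XFH i : F i + H i != 0 -> X i.
  have [->|/XF//] := eqVneq (F i) 0.
  by rewrite add0r => /XH.
by rewrite (sum_on finX XF) (sum_on finX XH) (sum_on finX XFH) big_split.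
Qed.

End FiniteSums.

Lemma sum_exchange (I J : choiceType) (A : pzRingType) (t : I -> J -> A) 
    (X : set I) (Y : set J) :
  finite_set X -> finite_set Y -> (forall i j, t i j != 0 -> X i /\ Y j) ->
  \sum_(i \in [set: I]) \sum_(j \in [set: J]) t i j =
  \sum_(j \in [set: J]) \sum_(i \in [set: I]) t i j.
Proof.
move=> finX finY tXY.
have tX i : \sum_(j <- fset_set Y) t i j != 0 -> X i.
  by apply: contra_neqP => Xi; apply: big1 => j _; apply: contrapT => /eqP/tXY[Xi1 _]; exact: Xi.
have tY j : \sum_(i <- fset_set X) t i j != 0 -> Y j.
  by apply: contra_neqP => Yj; apply: big1 => i _; apply: contrapT => /eqP/tXY[_ Yj1]; exact: Yj.
under eq_fsbigr => i _ do rewrite (sum_on finY (fun j h => (tXY i j h).2)).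
under [RHS]eq_fsbigr => j _ do rewrite (sum_on finX (fun i h => (tXY i j h).1)).
by rewrite (sum_on finX tX) (sum_on finY tY) exchange_big.
Qed.

Section FormalSeries.
Variables (Gam : groupType) (A : pzRingType).
Variables (P : homogeneousPieces Gam A) (F : supportFamily Gam).

Definition supp (x : Gam -> A) : set Gam := [set g | x g != 0].

Definition series_pred : {pred Gam -> A} :=
  fun x => `[< (forall g, P g (x g)) /\ F (supp x) >].

Record formal_series := Series {
  series_val :> Gam -> A;
  _ : series_val \in series_pred }.

HB.instance Definition _ := [isSub for series_val].
HB.instance Definition _ := [Choice of formal_series by <:].

Lemma seriesP (x : Gam -> A) :
  reflect ((forall g, P g (x g)) /\ F (supp x)) (x \in series_pred).
Proof. exact: asboolP. Qed.

Fact series_zmod_closed : zmod_closed series_pred.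
Proof.
split=> [|x y /seriesP[Px Fx] /seriesP[Py Fy]]; apply/seriesP; split.
- by move=> g; exact: hp_0.
- by apply: (@sf_sub _ F _ set0) _ (sf_finite F (finite_set0 _)) => g /eqP[].
- by move=> g; exact: hp_B.
- apply: (sf_sub _ (sf_U Fx Fy)) => g; rewrite /supp /=.
  have [xg|xg _] := eqVneq (x g) 0; last by left.
  by move=> H; right; apply: contra_neq H => yg; rewrite addrfctE opprfctE xg yg subrr.
Qed.

HB.instance Definition _ :=
  GRing.SubChoice_isSubZmodule.Build (Gam -> A) series_pred formal_series
    series_zmod_closed.

Implicit Types x y z : formal_series.

Lemma series_piece x g : P g (x g).
Proof. by have /seriesP[] := valP x. Qed.

Lemma series_supp x : F (supp x).
Proof. by have /seriesP[] := valP x. Qed.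

Lemma seriesD x y g : (x + y) g = x g + y g.
Proof. by []. Qed.

Lemma hp_sum (I : choiceType) g (f : I -> A) :
  (forall i, P g (f i)) -> P g (\sum_(i \in [set: I]) f i).
Proof.
move=> Pf; apply: (big_ind (P g)) => [|a b Pa Pb|i _]; last exact: Pf.
  exact: hp_0.
by rewrite -[b]opprK; apply: hp_B => //; rewrite -[- b]sub0r;
  apply: hp_B => //; exact: hp_0.
Qed.

Lemma conv_fin x y g :
  finite_set [set a | x a * y (a^-1 * g)%g != 0].
Proof.
apply: sub_finite_set (sf_fin (series_supp x) (series_supp y) g) => a /= xy.
by split; rewrite /supp /=; apply: contra_neq xy => ->; rewrite ?mul0r ?mulr0.
Qed.

Fact conv_series x y : convolution x y \in series_pred.
Proof.
apply/seriesP; split=> [g|].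
  apply: hp_sum => a; rewrite -{1}(mulVKg a g); apply: hp_M; exact: series_piece.
apply: (sf_sub _ (sf_M (series_supp x) (series_supp y))) => g.
rewrite /supp /= /convolution => /sum_neq0[a xy].
by exists a; rewrite /supp /=; apply: contra_neq xy => ->;
  rewrite ?mul0r ?mulr0.
Qed.

Definition series_mul x y : formal_series := Series (conv_series x y).

Definition monomial (h : Gam) (a : A) : Gam -> A :=
  fun g => if g == h then a else 0.

Lemma monomial_series h a : P h a -> monomial h a \in series_pred.
Proof.
move=> Pa; apply/seriesP; split=> [g|].
  by rewrite /monomial; case: eqP => [->//|_]; exact: hp_0.
apply: sf_finite; apply: sub_finite_set (finite_set1 h) => g.
by rewrite /supp /monomial /=; have [->|_] := eqVneq g h; rewrite ?eqxx.
Qed.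

Definition series_one : formal_series := Series (monomial_series (hp_1 P)).

Lemma conv_monomiall h a (y : Gam -> A) g :
  convolution (monomial h a) y g = a * y (h^-1 * g)%g.
Proof.
rewrite /convolution (@sum_single _ _ _ h) /monomial /= => [|j /negPf->].
  by rewrite eqxx.
by rewrite mul0r.
Qed.

Lemma conv_monomialr h a (y : Gam -> A) g :
  convolution y (monomial h a) g = y (g * h^-1)%g * a.
Proof.
rewrite /convolution (@sum_single _ _ _ (g * h^-1)%g).
  by rewrite /monomial invgM invgK mulgVK eqxx.
move=> j jgh; rewrite /monomial ifN ?mulr0//; apply: contra jgh => /eqP <-.
by rewrite invgM invgK mulVKg.
Qed.

Fact series_mulA : associative series_mul.
Proof.
move=> x y z; apply/val_inj/funext => g /=; rewrite /convolution /=.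
pose S := supp y; pose T := supp z.
pose X := [set a | supp x a /\
  exists2 b, supp y b & supp z (b^-1 * (a^-1 * g))%g].
have finX : finite_set X.
  exact: sf_fin (series_supp x) (sf_M (series_supp y) (series_supp z)) g.
pose Y := \bigcup_(a in X) [set (a * b)%g | b in
  [set b | supp y b /\ supp z (b^-1 * (a^-1 * g))%g]].
have finY : finite_set Y.
  apply: bigcup_finite => // a _; apply: finite_image.
  exact: sf_fin (series_supp y) (series_supp z) _.
pose t a c := x a * y (a^-1 * c)%g * z (c^-1 * g)%g.
have tXY a c : t a c != 0 -> X a /\ Y c.
  move=> tn0.
  have xa : supp x a by apply: contra_neq tn0 => xa; rewrite /t xa !mul0r.
  have yc : supp y (a^-1 * c)%g.
    by apply: contra_neq tn0 => yc; rewrite /t yc mulr0 mul0r.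
  have zc : supp z (c^-1 * g)%g.
    by apply: contra_neq tn0 => zc; rewrite /t zc mulr0.
  have zc' : supp z ((a^-1 * c)^-1 * (a^-1 * g))%g.
    by rewrite invgM invgK -mulgA mulVKg.
  have Xa : X a by split=> //; exists (a^-1 * c)%g.
  by split=> //; exists a => //; exists (a^-1 * c)%g => //; rewrite mulVKg.
transitivity (\sum_(a \in [set: Gam]) \sum_(c \in [set: Gam]) t a c).
  apply: eq_fsbigr => a _; rewrite sum_mulr; last exact: conv_fin.
  rewrite (reindex_fsbigT (fun c => (a^-1 * c)%g)); last first.
    by exists (fun b => (a * b)%g) => c; rewrite ?mulKg ?mulVKg.
  by apply: eq_fsbigr => c _; rewrite /t mulrA invgM invgK -mulgA mulVKg.
rewrite (sum_exchange finX finY tXY); apply: eq_fsbigr => c _.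
by rewrite sum_mull//; exact: conv_fin.
Qed.

Fact series_mul1 : left_id series_one series_mul.
Proof.
move=> x; apply/val_inj/funext => g /=.
by rewrite conv_monomiall mul1r invg1 mul1g.
Qed.

Fact series_mulr1 : right_id series_one series_mul.
Proof.
move=> x; apply/val_inj/funext => g /=.
by rewrite conv_monomialr mulr1 invg1 mulg1.
Qed.

Fact series_mulDl : left_distributive series_mul +%R.
Proof.
move=> x y z; apply/val_inj/funext => g.
rewrite -[RHS]/(convolution x z g + convolution y z g) /convolution.
rewrite -sum_add; [|exact: conv_fin|exact: conv_fin].
by apply: eq_fsbigr => a _; rewrite -mulrDl.
Qed.

Fact series_mulDr : right_distributive series_mul +%R.
Proof.
move=> x y z; apply/val_inj/funext => g.
rewrite -[RHS]/(convolution x y g + convolution x z g) /convolution.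
rewrite -sum_add; [|exact: conv_fin|exact: conv_fin].
by apply: eq_fsbigr => a _; rewrite -mulrDr.
Qed.

HB.instance Definition _ := GRing.Zmodule_isPzRing.Build formal_series
  series_mulA series_mul1 series_mulr1 series_mulDl series_mulDr.

Lemma seriesM x y g : (x * y) g = convolution x y g.
Proof. by []. Qed.

Lemma series1 g : (1 : formal_series) g = monomial 1%g 1 g.
Proof. by []. Qed.

Lemma series_sum (I : choiceType) (f : I -> formal_series) g :
  finite_set [set i | f i != 0] ->
  (\sum_(i \in [set: I]) f i) g = \sum_(i \in [set: I]) f i g.
Proof.
move=> fin; rewrite (sum_on fin)// (@sum_on _ _ (fun i => f i g) _ fin) => [|i]; last first.
  by apply: contra_neq => ->.
elim/big_rec2: _ => [//|i a b _ <-]; exact: seriesD.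
Qed.

End FormalSeries.

(* A [Gam]-graded ring with a unit in every homogeneous component; the direct *)
(* sum decomposition is recorded by the projections [cp_comp] onto the        *)
(* components.                                                                *)
Record crossedProduct (Gam : groupType) := CrossedProduct {
  cp_ring :> pzRingType;
  cp_hom : homogeneousPieces Gam cp_ring;
  cp_comp : cp_ring -> Gam -> cp_ring;
  cp_compP : forall x g, cp_hom g (cp_comp x g);
  cp_fin : forall x, finite_set [set g | cp_comp x g != 0];
  cp_sum : forall x, \sum_(g \in [set: Gam]) cp_comp x g = x;
  cp_uniq : forall c : Gam -> cp_ring, (forall g, cp_hom g (c g)) ->
    finite_set [set g | c g != 0] ->
    forall g, cp_comp (\sum_(h \in [set: Gam]) c h) g = c g;
  cp_unit : forall g, exists u v, [/\ cp_hom g u, u * v = 1 & v * u = 1] }.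

Section CrossedProductTheory.
Variables (Gam : groupType) (C : crossedProduct Gam).

Lemma cp_comp_sum (c : Gam -> C) x : (forall g, cp_hom C g (c g)) ->
  finite_set [set g | c g != 0] -> \sum_(h \in [set: Gam]) c h = x ->
  cp_comp x = c.
Proof. by move=> Pc fin <-; apply/funext; exact: cp_uniq. Qed.

Lemma cp_comp_hom g (x : C) : cp_hom C g x -> cp_comp x = monomial g x.
Proof.
move=> Px; apply: cp_comp_sum => [h||].
- by rewrite /monomial; case: eqP => [->//|_]; exact: hp_0.
- apply: sub_finite_set (finite_set1 g) => h; rewrite /monomial /=.
  by have [->|_] := eqVneq h g; rewrite ?eqxx.
- rewrite (@sum_single _ _ _ g) /monomial /= => [|j /negPf->//].
  by rewrite eqxx.
Qed.

Lemma cp_compD (x y : C) g : cp_comp (x + y) g = cp_comp x g + cp_comp y g.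
Proof.
suff -> : cp_comp (x + y) = (fun g => cp_comp x g + cp_comp y g) by [].
apply: cp_comp_sum => [h||].
- rewrite -[cp_comp y h]opprK; apply: hp_B; first exact: cp_compP.
  by rewrite -[- _]sub0r; apply: hp_B; [exact: hp_0|exact: cp_compP].
- apply: sub_finite_set (_ : finite_set ([set g | cp_comp x g != 0] `|`
      [set g | cp_comp y g != 0])) => [h /=|]; last first.
    by rewrite finite_setU; split; exact: cp_fin.
  have [->|] := eqVneq (cp_comp x h) 0; last by left.
  by rewrite add0r; right.
- by rewrite sum_add ?cp_sum//; exact: cp_fin.
Qed.

Lemma cp_compN (x : C) g : cp_comp (- x) g = - cp_comp x g.
Proof.
have comp0 : cp_comp (0 : C) g = 0.
  by rewrite (cp_comp_hom (hp_0 _ g)) /monomial; case: eqP.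
by apply/eqP; rewrite -subr_eq0 opprK addrC -cp_compD subrr comp0.
Qed.

Lemma cp_compB (x y : C) g : cp_comp (x - y) g = cp_comp x g - cp_comp y g.
Proof. by rewrite cp_compD cp_compN. Qed.

Lemma cp_compM (x y : C) : cp_comp (x * y) = convolution (cp_comp x) (cp_comp y).
Proof.
pose X := [set g | cp_comp x g != 0]; pose Y := [set g | cp_comp y g != 0].
have finX : finite_set X := cp_fin x; have finY : finite_set Y := cp_fin y.
pose Z := \bigcup_(a in X) [set (a * b)%g | b in Y].
have finZ : finite_set Z.
  by apply: bigcup_finite => // a _; exact: finite_image.
pose t a c := cp_comp x a * cp_comp y (a^-1 * c)%g.
have tXZ a c : t a c != 0 -> X a /\ Z c.
  move=> tn0.
  have Xa : X a by apply: contra_neq tn0 => xa; rewrite /t xa mul0r.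
  have Yc : Y (a^-1 * c)%g by apply: contra_neq tn0 => yc; rewrite /t yc mulr0.
  by split=> //; exists a => //; exists (a^-1 * c)%g => //; rewrite mulVKg.
apply: cp_comp_sum => [g||].
- by rewrite /convolution; apply: hp_sum => a; rewrite -{1}(mulVKg a g); apply: hp_M; exact: cp_compP.
- by apply: sub_finite_set finZ => c /= /sum_neq0[a /tXZ[]].
- rewrite /convolution -(sum_exchange finX finZ tXZ).
  rewrite -[in RHS](cp_sum x) sum_mull; last exact: cp_fin.
  apply: eq_fsbigr => a _; rewrite -[in RHS](cp_sum y) sum_mulr; last exact: cp_fin.
  rewrite [RHS](reindex_fsbigT (fun c => (a^-1 * c)%g))//.
  by exists (fun b => (a * b)%g) => c; rewrite ?mulKg ?mulVKg.
Qed.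

Lemma cp_unit_inv g :
  exists u v : C, [/\ cp_hom C g u, cp_hom C g^-1%g v, u * v = 1 & v * u = 1].
Proof.
have [u [v [Pu uv vu]]] := cp_unit C g; exists u, v; split => //.
have uvc h : u * cp_comp v (g^-1 * h)%g = monomial 1%g 1 h.
  have := congr1 (fun z => cp_comp z h) uv.
  rewrite cp_compM (cp_comp_hom (hp_1 _)) (cp_comp_hom Pu) => <-.
  by rewrite conv_monomiall.
suff -> : v = cp_comp v g^-1%g by exact: cp_compP.
rewrite -[LHS]cp_sum (@sum_single _ _ _ g^-1%g)// => j jg.
have := uvc (g * j)%g; rewrite mulKg /monomial ifN.
  by move=> uj; rewrite -[cp_comp v j]mul1r -vu -mulrA uj mulr0.
by apply: contra jg => /eqP/mulg1_eq ->.
Qed.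

End CrossedProductTheory.

(* If every admissible support has finite image under [p : Gam -> Del], the   *)
(* series ring is the direct sum of its subgroups of series supported on the  *)
(* fibres of [p], hence a [Del]-graded ring.                                  *)
Section Regrade.
Variables (Gam Del : groupType) (p : Gam -> Del).
Hypothesis pM : {morph p : x y / (x * y)%g}.
Hypothesis p_surj : forall d, exists g, p g = d.
Variables (A : pzRingType) (P : homogeneousPieces Gam A) (F : supportFamily Gam).
Hypothesis F_fin : forall S, F S -> finite_set (p @` S).
Hypothesis P_unit : forall g, exists u v,
  [/\ P g u, P g^-1%g v, u * v = 1 & v * u = 1].

Definition fibre_set (d : Del) : set (formal_series P F) :=
  [set x | forall g, x g != 0 -> p g = d].

Fact fibre_0 d : fibre_set d 0.
Proof. by move=> g /eqP[]. Qed.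

Fact fibre_B d x y : fibre_set d x -> fibre_set d y -> fibre_set d (x - y).
Proof.
move=> Px Py g; have [xg|/Px//] := eqVneq (x g) 0.
move=> H; apply: Py; apply: contra_neq H => yg.
by rewrite -[LHS]/(x g - y g) xg yg subrr.
Qed.

Fact fibre_M d e x y :
  fibre_set d x -> fibre_set e y -> fibre_set (d * e)%g (x * y).
Proof.
move=> Px Py g /sum_neq0[a xy]; rewrite -(mulVKg a g) pM; congr (_ * _)%g.
  by apply: Px; apply: contra_neq xy => ->; rewrite mul0r.
by apply: Py; apply: contra_neq xy => ->; rewrite mulr0.
Qed.

Lemma regrade_p1 : p 1%g = 1%g.
Proof. by apply: (mulgI (p 1%g)); rewrite -pM !mulg1. Qed.

Fact fibre_1 : fibre_set 1%g 1.
Proof.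
move=> g; rewrite series1 /monomial; have [->|_] := eqVneq g 1%g.
  by rewrite regrade_p1.
by rewrite eqxx.
Qed.

Definition fibre_pieces := HomogeneousPieces fibre_0 fibre_B fibre_M fibre_1.

Definition fibre_fun (x : formal_series P F) (d : Del) : Gam -> A :=
  fun g => if p g == d then x g else 0.

Fact fibre_funP x d : fibre_fun x d \in series_pred P F.
Proof.
apply/seriesP; split=> [g|].
  by rewrite /fibre_fun; case: ifP => _; [exact: series_piece|exact: hp_0].
apply: (sf_sub _ (series_supp x)) => g; rewrite /supp /fibre_fun /=.
by case: ifP => // _; rewrite eqxx.
Qed.

Definition fibre_comp x d : formal_series P F := Series (fibre_funP x d).

Fact fibre_compP x d : fibre_pieces d (fibre_comp x d).
Proof.
by move=> g; rewrite /= /fibre_fun; have [//|_] := eqVneq (p g) d; rewrite eqxx.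
Qed.

Fact fibre_fin x : finite_set [set d | fibre_comp x d != 0].
Proof.
apply: sub_finite_set (F_fin (series_supp x)) => d /= xd.
apply: contrapT => nd; move/eqP: xd; apply; apply/val_inj/funext => g /=.
rewrite /fibre_fun; have [pg|//] := eqVneq (p g) d.
by apply: contrapT => /eqP xg; apply: nd; exists g.
Qed.

Fact fibre_sum x : \sum_(d \in [set: Del]) fibre_comp x d = x.
Proof.
apply/val_inj/funext => g; apply: etrans (series_sum g (fibre_fin x)) _.
rewrite (@sum_single _ _ _ (p g)) /= /fibre_fun ?eqxx// => d.
by rewrite eq_sym => /negPf->.
Qed.

Fact fibre_uniq (c : Del -> formal_series P F) : (forall d, fibre_pieces d (c d)) ->
  finite_set [set d | c d != 0] ->
  forall d, fibre_comp (\sum_(e \in [set: Del]) c e) d = c d.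
Proof.
move=> Pc fin d; apply/val_inj/funext => g.
rewrite -[LHS]/(if p g == d then (\sum_(e \in [set: Del]) c e) g else 0).
rewrite series_sum// (@sum_single _ _ _ (p g)) => [|e].
  have [->//|pgd] := eqVneq (p g) d.
  by apply/esym; apply: contra_neqP pgd => /eqP; exact: Pc.
by move=> epg; apply: contra_neqP epg => /eqP/Pc.
Qed.

Fact fibre_unit d : exists u v : formal_series P F,
  [/\ fibre_pieces d u, u * v = 1 & v * u = 1].
Proof.
have [g <-] := p_surj d; have [a [b [Pa Pb ab ba]]] := P_unit g.
exists (Series (monomial_series F Pa)), (Series (monomial_series F Pb)).
split.
- move=> h /=; rewrite /monomial; have [->//|_] := eqVneq h g.
  by rewrite eqxx.
- apply/val_inj/funext => h; rewrite /= conv_monomiall /monomial.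
  rewrite -(inj_eq (mulgI g)) mulVKg mulgV.
  by case: ifP; rewrite ?ab ?mulr0.
- apply/val_inj/funext => h; rewrite /= conv_monomiall /monomial.
  rewrite invgK -(inj_eq (mulgI g^-1%g)) mulKg mulVg.
  by case: ifP; rewrite ?ba ?mulr0.
Qed.

Definition regrade : crossedProduct Del :=
  CrossedProduct fibre_compP fibre_fin fibre_sum fibre_uniq fibre_unit.

End Regrade.

Definition trivial_QG (G : groupType) : Type := rat.

Section GroupRing.
Variable G : groupType.

Definition full_pieces : homogeneousPieces G rat.
Proof. by exists (fun _ => setT). Defined.

Fact finite_supports_M (S T : set G) : finite_set S -> finite_set T ->
  finite_set [set g | exists2 s, S s & T (s^-1 * g)%g].
Proof.
move=> finS finT; apply: (@sub_finite_set _ _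
    (\bigcup_(s in S) [set (s * t)%g | t in T])).
  by move=> g [s Ss Tg]; exists s => //; exists (s^-1 * g)%g; rewrite ?mulVKg.
by apply: bigcup_finite => // s _; exact: finite_image.
Qed.

Fact finite_supports_fin (S T : set G) : finite_set S -> finite_set T ->
  forall g, finite_set [set s | S s /\ T (s^-1 * g)%g].
Proof. by move=> finS _ g; apply: sub_finite_set finS => s []. Qed.

Fact finite_supports_U (S T : set G) : finite_set S -> finite_set T ->
  finite_set (S `|` T).
Proof. by rewrite finite_setU. Qed.

Definition finite_supports : supportFamily G :=
  SupportFamily (@sub_finite_set G) finite_supports_U finite_supports_M
    finite_supports_fin (fun _ finS => finS).

Definition QG : pzRingType := formal_series full_pieces finite_supports.

Definition QG_of (g : G) : QG :=
  Series (monomial_series finite_supports (I : full_pieces g 1)).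

Definition augmentation (a : QG) : rat := \sum_(g \in [set: G]) a g.

Lemma augmentation1 : augmentation 1 = 1.
Proof.
rewrite /augmentation (@sum_single _ _ _ 1%g) ?series1 /monomial ?eqxx//.
by move=> j /negPf; rewrite series1 /monomial => ->.
Qed.

Lemma augmentationD a b : augmentation (a + b) = augmentation a + augmentation b.
Proof.
exact: (sum_add (series_supp a : finite_set _) (series_supp b : finite_set _)).
Qed.

Lemma augmentationM a b : augmentation (a * b) = augmentation a * augmentation b.
Proof.
have finA : finite_set (supp a) := series_supp a.
have finB : finite_set (supp b) := series_supp b.
pose t h g := a h * b (h^-1 * g)%g.
have finC := finite_supports_M finA finB.
rewrite /augmentation -(sum_exchange finA finC (t := t)) => [|h g tn0].
  rewrite sum_mull//; apply: eq_fsbigr => h _; rewrite sum_mulr//.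
  rewrite [RHS](reindex_fsbigT (fun c => (h^-1 * c)%g))//.
  by exists (fun b => (h * b)%g) => c; rewrite ?mulKg ?mulVKg.
have ah : supp a h by apply: contra_neq tn0 => ah; rewrite /t ah mul0r.
split=> //; exists h => //; apply: contra_neq tn0 => bh.
by rewrite /t bh mulr0.
Qed.

HB.instance Definition _ := GRing.Zmodule.copy (trivial_QG G) rat.

Definition trivial_scale (a : QG) (q : trivial_QG G) : trivial_QG G :=
  augmentation a * (q : rat).

Fact trivial_scaleA a b v :
  trivial_scale a (trivial_scale b v) = trivial_scale (a * b) v.
Proof. by rewrite /trivial_scale augmentationM mulrA. Qed.
Fact trivial_scale1 : left_id 1 trivial_scale.
Proof. by move=> v; rewrite /trivial_scale augmentation1 mul1r. Qed.
Fact trivial_scaleDr : right_distributive trivial_scale +%R.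
Proof. by move=> a u v; rewrite /trivial_scale mulrDr. Qed.
Fact trivial_scaleDl v : {morph trivial_scale^~ v : a b / a + b}.
Proof. by move=> a b; rewrite /trivial_scale augmentationD mulrDl. Qed.

HB.instance Definition _ := GRing.Zmodule_isLmodule.Build QG (trivial_QG G)
  trivial_scaleA trivial_scale1 trivial_scaleDr trivial_scaleDl.

(* Homogeneous cochains: [Hom_QG (Q[G^(n+1)], M)]. *)
Section Cohomology.
Variable M : lmodType QG.

Definition cochain n (f : ('I_n.+1 -> G) -> M) : Prop :=
  forall (h : G) (g : 'I_n.+1 -> G),
    f (fun i => (h * g i)%g) = QG_of h *: f g.

Definition coboundary n (f : ('I_n.+1 -> G) -> M) (g : 'I_n.+2 -> G) : M :=
  \sum_(i < n.+2) (-1) ^+ i *: f (fun j => g (lift i j)).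

Definition is_cocycle n (f : ('I_n.+1 -> G) -> M) : Prop :=
  cochain f /\ forall g, coboundary f g = 0.

Definition is_coboundary n : (('I_n.+1 -> G) -> M) -> Prop :=
  match n with
  | 0 => fun f => forall g, f g = 0
  | m.+1 => fun f => exists2 e : ('I_m.+1 -> G) -> M,
      cochain e & forall g, f g = coboundary e g
  end.

Definition cohomology_zero n : Prop :=
  forall f : ('I_n.+1 -> G) -> M, is_cocycle f -> is_coboundary f.

End Cohomology.

Definition cdQ (R : realType) : \bar R :=
  ereal_sup [set (n%:R)%:E | n in
    [set n | exists M : lmodType QG, ~ cohomology_zero M n]].

End GroupRing.

Section Modules.
Variable A : pzRingType.

Definition projective (P : lmodType A) : Prop :=
  forall (M N : lmodType A) (f : {linear M -> N}) (g : {linear P -> N}),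
    (forall y, exists x, f x = y) ->
    exists h : {linear P -> M}, forall x, f (h x) = g x.

Definition finitely_generated (M : lmodType A) : Prop :=
  exists n (e : 'I_n -> M),
    forall x, exists a : 'I_n -> A, x = \sum_(i < n) a i *: e i.

Definition finite_length_fgp_resolution (V : lmodType A) (L : nat)
    (P : nat -> lmodType A) (d : forall i, {linear P i.+1 -> P i})
    (eps : {linear P 0%N -> V}) : Prop :=
  [/\ forall i, projective (P i) /\ finitely_generated (P i),
      forall i, (L < i)%N -> forall x : P i, x = 0,
      forall v, exists x, eps x = v,
      forall x, eps x = 0 <-> exists y, d 0%N y = x &
      forall i x, d i x = 0 <-> exists y, d i.+1 y = x].

End Modules.

Definition type_FPQ (G : groupType) : Prop :=
  exists L (P : nat -> lmodType (QG G)) d eps,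
    @finite_length_fgp_resolution _ (trivial_QG G) L P d eps.

(* One completion step. Let [C] be a [Gam]-crossed product, [S * Gam] with    *)
(* [S] its component of degree 1, let [p : Gam -> Del] be onto with central   *)
(* kernel [K], and let [chi : K -> R] be a homomorphism. Then                 *)
(*   [S * Gam = (S * K) * Del] embeds in [(Novikov ring of (S * K, chi)) * Del]. *)
(* An element of the latter is a finite sum over cosets [K g] of series       *)
(* [(sum_k s_k u_k) u_g], where [{k | s_k <> 0, chi k <= t}] is finite for    *)
(* all [t]; so it is a family [x] with [x_g] in [C_g] and support in the      *)
(* following family. When [Del] is trivial this is the Novikov ring itself.   *)
Section NovikovStep.
Variables (R : realType) (Gam Del : groupType) (p : Gam -> Del).
Hypothesis pM : {morph p : x y / (x * y)%g}.
Hypothesis p_surj : forall d, exists g, p g = d.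
Variable K : normalSubgroup Gam.
Hypothesis p_ker : forall g, (p g = 1%g) <-> g \in K.
Hypothesis K_central : forall x y : Gam, x \in K -> (x * y = y * x)%g.
Variable chi : subgroup_of K -> R.
Hypothesis chiM : forall x y, chi (x * y)%g = chi x + chi y.

Definition novikov_support (S : set Gam) : Prop :=
  finite_set (p @` S) /\
  forall (g : Gam) (t : R),
    finite_set [set k : subgroup_of K | S (val k * g)%g /\ chi k <= t].

Lemma finite_lower_bound (T : choiceType) (f : T -> R) (X : set T) :
  finite_set X -> exists m, forall x, X x -> m <= f x.
Proof.
move=> /finite_seqP[s ->]; elim: s => [|a s [m ms]]; first by exists 0.
exists (Num.min (f a) m) => x /=; rewrite inE => /orP[/eqP->|xs].
  by rewrite ge_min lexx.
by rewrite ge_min ms ?orbT.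
Qed.

Lemma bounded_below (X : set (subgroup_of K)) :
  (forall t, finite_set [set k | X k /\ chi k <= t]) ->
  exists m, forall k, X k -> m <= chi k.
Proof.
move=> finX; have [[k Xk]|nX] := pselect (exists k, X k); last first.
  by exists 0 => k Xk; case: nX; exists k.
have [m mX] := finite_lower_bound chi (finX (chi k)).
exists (Num.min m (chi k)) => l Xl; rewrite ge_min.
have [lk|/ltW->] := leP (chi l) (chi k); last by rewrite orbT.
by rewrite mX.
Qed.

Lemma novikov_pairs_fibre (S T : set Gam) g t u v :
  novikov_support S -> novikov_support T ->
  finite_set [set kl : subgroup_of K * subgroup_of K |
    [/\ S (val kl.1 * u)%g, T (val kl.2 * v)%g & exists2 k : subgroup_of K,
      (val kl.1 * u * (val kl.2 * v) = val k * g)%g & chi k <= t]].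
Proof.
move=> [_ /(_ u) finS] [_ /(_ v) finT].
set X := [set _ | _].
have [[[k0 l0] /= [Sk0 Tl0 [m0 E0 m0t]]]|nX] := pselect (exists kl, X kl); last first.
  rewrite (_ : X = set0)//; apply/seteqP; split=> // kl Xkl.
  by case: nX; exists kl.
have [a aS] := bounded_below finS; have [b bT] := bounded_below finT.
pose c := chi m0 - chi k0 - chi l0.
apply: sub_finite_set (finite_setX (finS (t - c - b)) (finT (t - c - a))).
move=> [k l] /= [Sk Tl [m E mt]].
have Em : (m * k0 * l0 = k * l * m0)%g.
  apply: val_inj; rewrite !valM.
  have C (x : subgroup_of K) y : (val x * y = y * val x)%g.
    by apply: K_central; exact: (valP x).
  have red (x y : subgroup_of K) :
      (val x * u * (val y * v) = val x * val y * (u * v))%g.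
    by rewrite -mulgA (mulgA u) -(C y u) !mulgA.
  have solve (x y z : subgroup_of K) :
      (val x * u * (val y * v) = val z * g)%g ->
      (val z = val x * val y * (u * v * g^-1))%g.
    by rewrite red => /esym/(canRL (mulgK g)) ->; rewrite -!mulgA.
  rewrite (solve _ _ _ E) (solve _ _ _ E0); move: (u * v * g^-1)%g => w.
  have Cw : (w * val k0 * val l0 = val k0 * val l0 * w)%g.
    by rewrite -(C k0 w) -!mulgA (C l0 w).
  by rewrite -!mulgA in Cw *; rewrite Cw.
have := congr1 chi Em; rewrite !chiM => {}Em.
have ak := aS _ Sk; have bl := bT _ Tl.
by split; split => //; rewrite /c; lra.
Qed.

Lemma p_val (k : subgroup_of K) g : p (val k * g)%g = p g.
Proof. by rewrite pM (p_ker _).2 ?mul1g//; exact: (valP k). Qed.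

Lemma same_fibre a b : p a = p b -> exists k : subgroup_of K, a = (val k * b)%g.
Proof.
move=> pab; have Kab : (a * b^-1)%g \in K.
  by apply/p_ker; rewrite pM pab -pM mulgV; apply: (mulgI (p 1%g)); rewrite -pM !mulg1.
by exists (exist (fun x : Gam => x \in ns_pred K) _ Kab); rewrite /= mulgVK.
Qed.

Lemma novikov_pairs (S T : set Gam) g t :
  novikov_support S -> novikov_support T ->
  finite_set [set ab : Gam * Gam | [/\ S ab.1, T ab.2 &
    exists2 k : subgroup_of K, (ab.1 * ab.2 = val k * g)%g & chi k <= t]].
Proof.
move=> nS nT; have [s sK] := choice p_surj.
pose Y d e := [set ((val kl.1 * s d)%g, (val kl.2 * s e)%g) |
  kl in [set kl : subgroup_of K * subgroup_of K |
    [/\ S (val kl.1 * s d)%g, T (val kl.2 * s e)%g & exists2 k : subgroup_of K,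
      (val kl.1 * s d * (val kl.2 * s e) = val k * g)%g & chi k <= t]]].
apply: (@sub_finite_set _ _ (\bigcup_(d in p @` S) \bigcup_(e in p @` T) Y d e)).
  move=> [a b] /= [Sa Tb H].
  have [k Ek] := same_fibre (esym (sK (p a))).
  have [l El] := same_fibre (esym (sK (p b))).
  exists (p a); first by exists a.
  exists (p b); first by exists b.
  by exists (k, l) => /=; rewrite -Ek -El.
apply: bigcup_finite => [|d _]; first exact: nS.1.
apply: bigcup_finite => [|e _]; first exact: nT.1.
by apply: finite_image; exact: novikov_pairs_fibre.
Qed.

Lemma val_finite (X : set Gam) g : finite_set X ->
  finite_set [set k : subgroup_of K | X (val k * g)%g].
Proof.
apply: (finite_preimage (f := fun k : subgroup_of K => (val k * g)%g)).
by move=> k l _ _ /(can_inj (mulgK g))/val_inj.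
Qed.

Fact novikov_sub (S T : set Gam) :
  S `<=` T -> novikov_support T -> novikov_support S.
Proof.
move=> ST [finT fT]; split=> [|g t].
  by apply: sub_finite_set finT => _ [a /ST Ta <-]; exists a.
by apply: sub_finite_set (fT g t) => k [/ST].
Qed.

Fact novikov_U (S T : set Gam) :
  novikov_support S -> novikov_support T -> novikov_support (S `|` T).
Proof.
move=> [finS fS] [finT fT]; split=> [|g t].
  by rewrite image_setU finite_setU.
have := conj (fS g t) (fT g t); rewrite -finite_setU; apply: sub_finite_set.
by move=> k [[Sk|Tk] kt]; [left|right].
Qed.

Fact novikov_M (S T : set Gam) : novikov_support S -> novikov_support T ->
  novikov_support [set g | exists2 s, S s & T (s^-1 * g)%g].
Proof.
move=> nS nT; split=> [|g t].
  apply: (@sub_finite_set _ _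
      (\bigcup_(d in p @` S) [set (d * e)%g | e in p @` T])).
    move=> _ [g [s Ss Tg] <-]; exists (p s); first by exists s.
    exists (p (s^-1 * g)%g); first by exists (s^-1 * g)%g.
    by rewrite -pM mulVKg.
  by apply: bigcup_finite => [|d _]; [exact: nS.1|apply: finite_image; exact: nT.1].
have := finite_image (fun ab : Gam * Gam => (ab.1 * ab.2)%g)
  (novikov_pairs g t nS nT) => /(val_finite g).
apply: sub_finite_set => k [[s Ss Tk] kt].
exists (s, (s^-1 * (val k * g))%g) => /=; last by rewrite mulVKg.
by split=> //; exists k; rewrite ?mulVKg.
Qed.

Lemma chi1 : chi 1%g = 0.
Proof. by apply: (addrI (chi 1%g)); rewrite -chiM mulg1 addr0. Qed.

Fact novikov_fin (S T : set Gam) : novikov_support S -> novikov_support T ->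
  forall g, finite_set [set s | S s /\ T (s^-1 * g)%g].
Proof.
move=> nS nT g; have := finite_image fst (novikov_pairs g 0 nS nT).
apply: sub_finite_set => s [Ss Ts]; exists (s, (s^-1 * g)%g) => //=.
split=> //; exists 1%g; last by rewrite chi1.
by rewrite /= mulVKg mul1g.
Qed.

Fact novikov_finite (S : set Gam) : finite_set S -> novikov_support S.
Proof.
move=> finS; split=> [|g t]; first exact: finite_image.
by apply: sub_finite_set (val_finite g finS) => k [].
Qed.

Definition novikov_family : supportFamily Gam :=
  SupportFamily novikov_sub novikov_U novikov_M novikov_fin novikov_finite.

Fact novikov_family_fin (S : set Gam) :
  novikov_family S -> finite_set (p @` S).
Proof. by case. Qed.

Variable C : crossedProduct Gam.

Definition novikov_step : crossedProduct Del :=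
  regrade pM p_surj novikov_family_fin (cp_unit_inv C).

Fact novikov_inclP (x : C) :
  cp_comp x \in series_pred (cp_hom C) novikov_family.
Proof.
apply/seriesP; split; first exact: cp_compP.
by apply: sf_finite; exact: cp_fin.
Qed.

Definition novikov_incl (x : C) : novikov_step := Series (novikov_inclP x).

Fact novikov_incl_zmod : zmod_morphism novikov_incl.
Proof. by move=> x y; apply/val_inj/funext => g; exact: cp_compB. Qed.

Fact novikov_incl_monoid : monoid_morphism novikov_incl.
Proof.
split=> [|x y]; apply/val_inj/funext => g.
  by rewrite /= (cp_comp_hom (hp_1 _)).
by rewrite /= cp_compM.
Qed.

HB.instance Definition _ :=
  GRing.isZmodMorphism.Build C novikov_step novikov_incl novikov_incl_zmod.
HB.instance Definition _ :=
  GRing.isMonoidMorphism.Build C novikov_step novikov_incl novikov_incl_monoid.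

Definition novikov_inclusion : {rmorphism C -> novikov_step} := novikov_incl.

End NovikovStep.

Section QuotientMap.
Variables (Q : groupType) (H L : normalSubgroup Q).
Hypothesis HL : forall x, x \in H -> x \in L.

Definition quo_map (q : quotient_by H) : quotient_by L := qproj L (lift_of q).

Lemma quo_map_qproj x : quo_map (qproj H x) = qproj L x.
Proof.
rewrite /quo_map; have [k Hk ->] := lift_of_qproj H x.
by apply/qprojP; rewrite invgM mulgVK; apply: nsV; exact: HL.
Qed.

Fact quo_mapM : {morph quo_map : x y / (x * y)%g}.
Proof.
move=> x y; have [a <-] := qproj_surj x; have [b <-] := qproj_surj y.
by rewrite -qprojM !quo_map_qproj qprojM.
Qed.

Fact quo_map_surj d : exists g, quo_map g = d.
Proof. by have [x <-] := qproj_surj d; exists (qproj H x); exact: quo_map_qproj. Qed.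

Fact quo_map_ker g : (quo_map g = 1%g) <-> g \in quo_subgroup H L.
Proof.
split=> [|/quo_predP[l Ll <-]]; last by rewrite quo_map_qproj; apply/qproj_eq1.
have [x <-] := qproj_surj g; rewrite quo_map_qproj => /qproj_eq1 Lx.
by apply/quo_predP; exists x.
Qed.

End QuotientMap.

(* [1 = Q_n <= ... <= Q_0 = Q] with [Q_i / Q_(i+1)] central in [Q / Q_(i+1)], *)
(* continued by [Q_i = 1] for [i > n], as the third condition forces.         *)
Definition central_series (Q : groupType) (n : nat)
    (s : nat -> normalSubgroup Q) : Prop :=
  [/\ forall x, x \in s 0%N,
      forall x, x \in s n <-> x = 1%g,
      forall i x, x \in s i.+1 -> x \in s i &
      forall i (x y : quotient_by (s i.+1)),
        x \in quo_subgroup (s i.+1) (s i) -> (x * y = y * x)%g].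

Definition nilpotent_group (Q : groupType) : Prop :=
  exists n s, @central_series Q n s.

(* [mc_char i] is the character [chi_(i+1)] of [Q_i / Q_(i+1)]; it is zero    *)
(* for [i >= n], where this group is trivial.                                 *)
Record multicharacter (R : realType) (Q : groupType) (n : nat) :=
  Multicharacter {
  mc_series : nat -> normalSubgroup Q;
  mc_central : central_series n mc_series;
  mc_char : forall i,
    subgroup_of (quo_subgroup (mc_series i.+1) (mc_series i)) -> R;
  mc_charM : forall i x y, mc_char (i := i) (x * y)%g = mc_char x + mc_char y }.

Section Signs.
Variables (R : realType) (Q : groupType) (n : nat) (chi : multicharacter R Q n).
Variable eps : n.-tuple bool.

Definition signed_char i x : R :=
  (-1) ^+ nth false eps i * mc_char (m := chi) (i := i) x.

Fact signed_charM i x y :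
  signed_char (i := i) (x * y)%g = signed_char x + signed_char y.
Proof. by rewrite /signed_char mc_charM mulrDr. Qed.

(* [(+-chi_1, ..., +-chi_n)], with minus signs where [eps] is [true]. *)
Definition signed_multicharacter : multicharacter R Q n :=
  Multicharacter (mc_central chi) signed_charM.

End Signs.

Record crossedProductOver (B : pzRingType) (Gam : groupType) :=
  CrossedProductOver {
  cpo_cp :> crossedProduct Gam;
  cpo_incl : {rmorphism B -> cpo_cp} }.

Section NovikovTower.
Variables (G : groupType) (N : normalSubgroup G).
Notation Q := (quotient_by N).

Section GradedGroupRing.
Variable H : normalSubgroup Q.

Let p (g : G) : quotient_by H := qproj H (qproj N g).

Fact graded_pM : {morph p : x y / (x * y)%g}.
Proof. by move=> x y; rewrite /p !qprojM. Qed.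

Fact graded_p_surj d : exists g, p g = d.
Proof.
by have [q <-] := qproj_surj d; have [g <-] := qproj_surj q; exists g.
Qed.

Fact graded_fin (S : set G) : finite_supports G S -> finite_set (p @` S).
Proof. exact: finite_image. Qed.

Fact graded_unit (g : G) : exists u v,
  [/\ full_pieces G g u, full_pieces G g^-1%g v, u * v = 1 & v * u = 1].
Proof. by exists 1, 1; rewrite mulr1. Qed.

(* [QG = (Q M) * ((G / N) / H)], [M] the preimage of [H] in [G]. *)
Definition graded_group_ring : crossedProductOver (QG G) (quotient_by H) :=
  @CrossedProductOver (QG G) _
    (regrade graded_pM graded_p_surj graded_fin graded_unit) idfun.

End GradedGroupRing.

Variables (R : realType) (n : nat) (chi : multicharacter R Q n).
Notation Qs := (mc_series chi).

Fact mc_sub i x : x \in Qs i.+1 -> x \in Qs i.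
Proof. by case: (mc_central chi) => _ _ H _; exact: H. Qed.

Fact mc_comm i (x y : quotient_by (Qs i.+1)) :
  x \in quo_subgroup (Qs i.+1) (Qs i) -> (x * y = y * x)%g.
Proof. by case: (mc_central chi) => _ _ _; exact. Qed.

(* From [R_(i+1) * (Q / Q_(i+1))] to [R_i * (Q / Q_i)]. *)
Definition tower_step i (C : crossedProductOver (QG G) (quotient_by (Qs i.+1))) :
    crossedProductOver (QG G) (quotient_by (Qs i)) :=
  CrossedProductOver
    (novikov_inclusion (quo_mapM (@mc_sub i)) (quo_map_surj (@mc_sub i))
      (quo_map_ker (@mc_sub i)) (@mc_comm i) (@mc_charM _ _ _ chi i) C
     \o cpo_incl C).

(* [R_i * (Q / Q_i)] when [i + m = n]; the recursion starts at [i = n], where *)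
(* [R_n * (Q / Q_n)] is [QG].                                                 *)
Fixpoint novikov_tower (m i : nat) :
    crossedProductOver (QG G) (quotient_by (Qs i)) :=
  match m with
  | 0 => graded_group_ring (Qs i)
  | m'.+1 => tower_step (novikov_tower m' i.+1)
  end.

(* [R_0 * (Q / Q_0) = R_0]. *)
Definition novikov_ring : pzRingType := novikov_tower n 0.

Definition novikov_ring_incl : {rmorphism QG G -> novikov_ring} :=
  cpo_incl (novikov_tower n 0).

End NovikovTower.

Definition restrict_scalars (A B : pzRingType) (f : {rmorphism A -> B}) : Type :=
  B.

Section RestrictScalars.
Variables (A B : pzRingType) (f : {rmorphism A -> B}).

HB.instance Definition _ := GRing.Zmodule.copy (restrict_scalars f) B.

Definition restrict_scale (a : A) (b : restrict_scalars f) : restrict_scalars f :=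
  f a * (b : B).

Fact restrict_scaleA a b v :
  restrict_scale a (restrict_scale b v) = restrict_scale (a * b) v.
Proof. by rewrite /restrict_scale rmorphM mulrA. Qed.
Fact restrict_scale1 : left_id 1 restrict_scale.
Proof. by move=> v; rewrite /restrict_scale rmorph1 mul1r. Qed.
Fact restrict_scaleDr : right_distributive restrict_scale +%R.
Proof. by move=> a u v; rewrite /restrict_scale mulrDr. Qed.
Fact restrict_scaleDl v : {morph restrict_scale^~ v : a b / a + b}.
Proof. by move=> a b; rewrite /restrict_scale rmorphD mulrDl. Qed.

HB.instance Definition _ := GRing.Zmodule_isLmodule.Build A (restrict_scalars f)
  restrict_scaleA restrict_scale1 restrict_scaleDr restrict_scaleDl.

End RestrictScalars.

Definition novikov_module (G : groupType) (N : normalSubgroup G) (R : realType)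
    (n : nat) (chi : multicharacter R (quotient_by N) n) : lmodType (QG G) :=
  restrict_scalars (novikov_ring_incl chi).

(* Main.v *)
Require Import Defs.
From HB Require Import structures.
From mathcomp Require Import all_boot all_order all_algebra.
From mathcomp Require Import finmap lra.
From mathcomp Require Import all_classical reals ereal.

(* By Shapiro's lemma it suffices that H^d(G; B) = 0 for B = CoInd_N^G M, the *)
(* N-equivariant functions on G. Since cd G = d and G has a resolution by     *)
(* finitely generated projectives, every class in H^d(G; B) comes from a      *)
(* finitely generated submodule of B, and H^d(G; -) is right exact; so it     *)
(* suffices that each f in B lies in the image of a QG-linear map A -> B with *)
(* H^d(G; A) = 0. Cut f into 2^n pieces according to the signs of the         *)
(* characters chi_i on its support. On the piece with signs eps the support   *)
(* is bounded below for all the characters +-chi_i, so the product a * f      *)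
(* makes sense for every a in the Novikov ring with signs eps, and            *)
(* a |-> a * f is the required map.                                           *)

Set Implicit Arguments.
Unset Strict Implicit.
Unset Printing Implicit Defensive.

Import Order.TTheory GRing.Theory Num.Theory.
Local Open Scope classical_set_scope.
Local Open Scope ring_scope.

(** The hypothesis on $\mathrm{cd}_{\mathbb{Q}}(G)$ kills $H^{d+1}(G;-)$, which makes $H^d(G;-)$
    right exact ([is_coboundary_lift]). By [comparison_exists], every class in $H^d(G;B)$ is
    represented by [th \o tau], with [tau] a fixed cochain with values in the finitely generated
    projective [P d] and [th] a linear map [P d -> B]. Such a [th] lifts along any linear map into
    $B$ that hits the finitely many images of the generators, so it is enough to hit finite lists of
    elements of $B$ from acyclic modules ([vanishing_of_acyclic_covers]). With $B$ the coinduced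
    module, [shapiro] then carries the vanishing to $N$.

    For the product of a Novikov series $a$ with a function $f$ ([tower_evaluation]), the terms at a
    point $x$ are indexed by the degrees $h$ of $f$ for which $a$ is nonzero at $\deg(x)h^{-1}$.
    Since $f$ is bounded below, the characters of these degrees of $a$ are bounded above, and the
    Novikov condition leaves finitely many. A general $f$ is a sum of $2^n$ functions, each bounded
    below for one choice of signs ([sign_section], [coinduced_acyclic_cover]); this is why all signs
    occur in the hypothesis. *)

Section MakeLinear.
Variables (A : pzRingType) (U V : lmodType A) (f : U -> V).

(** The proof is an argument so that the linear structure can be attached to any function shown to
    be linear. *)
Definition linear_of (_ : linear f) : U -> V := f.

Variable flin : linear f.
HB.instance Definition _ :=
  GRing.isLinear.Build A U V *:%R (linear_of flin) flin.
Definition linear_pack : {linear U -> V} := linear_of flin.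
End MakeLinear.

(** * Submodules, and lifting along projective modules *)

Section Submodules.
Variables (A : pzRingType) (M : lmodType A).

Record submodule := Submodule {
  sm_set :> M -> Prop;
  sm_0 : sm_set 0;
  sm_lin : forall a x y, sm_set x -> sm_set y -> sm_set (a *: x + y) }.

Variable S : submodule.

Lemma smZ a x : S x -> S (a *: x).
Proof. by move=> Sx; rewrite -[_ *: _]addr0; apply: sm_lin => //; exact: sm_0. Qed.
Lemma smD x y : S x -> S y -> S (x + y).
Proof. by move=> Sx Sy; rewrite -[x]scale1r; exact: sm_lin. Qed.
Lemma smN x : S x -> S (- x).
Proof. by rewrite -scaleN1r; exact: smZ. Qed.
Lemma smB x y : S x -> S y -> S (x - y).
Proof. by move=> Sx /smN; exact: smD. Qed.
Lemma sm_sum (I : Type) (r : seq I) (F : I -> M) :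
  (forall i, S (F i)) -> S (\sum_(i <- r) F i).
Proof.
by move=> SF; elim/big_rec: _ => [|i x _]; [exact: sm_0|exact: smD].
Qed.

Definition sm_pred : {pred M} := fun x => `[< S x >].
Fact sm_closed : submod_closed sm_pred.
Proof.
split=> [|a x y /asboolP Sx /asboolP Sy]; apply/asboolP; first exact: sm_0.
exact: sm_lin.
Qed.

Definition sm_type : Type := {x : M | x \in sm_pred}.
HB.instance Definition _ := SubChoice.on sm_type.
HB.instance Definition _ :=
  GRing.SubChoice_isSubLmodule.Build A M sm_pred sm_type sm_closed.

Definition sm_of x (Sx : S x) : sm_type := exist _ x (asboolT Sx).
Lemma sm_valP (x : sm_type) : S (val x).
Proof. exact: asboolW (valP x). Qed.
End Submodules.

Definition sm_zero (A : pzRingType) (M : lmodType A) : submodule M.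
Proof.
by exists (fun x => x = 0) => // a x y -> ->; rewrite scaler0 addr0.
Defined.

Definition sm_ker (A : pzRingType) (M N : lmodType A) (f : {linear M -> N}) :
  submodule M.
Proof.
exists (fun x => f x = 0); first exact: linear0.
by move=> a x y fx fy; rewrite linearP fx fy scaler0 addr0.
Defined.

(* Splits the projection onto [P] of the submodule [R] of [P * J]. *)
Lemma projective_selection (A : pzRingType) (P J : lmodType A)
    (R : P -> J -> Prop) : projective P ->
  (forall p, exists j, R p j) ->
  R 0 0 ->
  (forall a p j q k, R p j -> R q k -> R (a *: p + q) (a *: j + k)) ->
  exists f : {linear P -> J}, forall p, R p (f p).
Proof.
move=> Pproj Rtot R0 Rlin.
pose S := @Submodule A (P * J)%type (fun x => R x.1 x.2) R0
  (fun a x y => Rlin a x.1 x.2 y.1 y.2).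
have l1 : linear (fun x : sm_type S => (val x).1) by move=> a x y; rewrite linearP.
have l2 : linear (fun x : sm_type S => (val x).2) by move=> a x y; rewrite linearP.
have [|h hP] := Pproj _ _ (linear_pack l1) (idfun : {linear P -> P}).
  by move=> p; have [j Rpj] := Rtot p; exists (@sm_of _ _ S (p, j) Rpj).
exists (linear_pack l2 \o h : {linear _ -> _}) => p.
have := sm_valP (h p); rewrite /= -[X in R X _]/(linear_pack l1 (h p)).
by rewrite hP.
Qed.

(** * The homogeneous bar complex *)

Section BarComplex.
Variable G : groupType.

Section Cobd.
Variable M : lmodType (QG G).

(* [coboundary], also allowed on functions of the empty tuple. *)
Definition cobd n (f : ('I_n -> G) -> M) (g : 'I_n.+1 -> G) : M :=
  \sum_(i < n.+1) (-1) ^+ i *: f (fun j => g (lift i j)).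

Definition fcons n x (g : 'I_n -> G) : 'I_n.+1 -> G :=
  fun i => if unlift ord0 i is Some j then g j else x.

Lemma fcons0 n x (g : 'I_n -> G) : fcons x g ord0 = x.
Proof. by rewrite /fcons unlift_none. Qed.
Lemma fconsS n x (g : 'I_n -> G) j : fcons x g (lift ord0 j) = g j.
Proof. by rewrite /fcons liftK. Qed.

Lemma fcons_eta n (g : 'I_n.+1 -> G) :
  g = fcons (g ord0) (fun j => g (lift ord0 j)).
Proof.
by apply/funext => i; case: (unliftP ord0 i) => [j|] ->; rewrite ?fconsS ?fcons0.
Qed.

(** Face 0 removes [x]; face [i + 1] keeps [x] and applies face [i] to [g], with the opposite
    sign. *)
Lemma cobd_fcons n (f : ('I_n.+1 -> G) -> M) x g :
  cobd f (fcons x g) = f g - cobd (fun h => f (fcons x h)) g.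
Proof.
rewrite {1}/cobd big_ord_recl expr0 scale1r; congr (_ + _).
  by congr f; apply/funext => j; rewrite fconsS.
rewrite /cobd -sumrN; apply: eq_bigr => i _.
rewrite lift0 exprS mulN1r scaleNr; congr (- (_ *: f _)).
apply/funext => j; case: (unliftP ord0 j) => [k|] ->.
  rewrite fconsS (_ : lift (lift ord0 i) (lift ord0 k) = lift ord0 (lift i k)).
    by rewrite fconsS.
  by apply: val_inj; rewrite /= /bump /= !add1n ltnS; case: leqP.
rewrite (_ : lift (lift ord0 i) ord0 = ord0) ?fcons0//.
exact: val_inj.
Qed.

Lemma cobdB n (f h : ('I_n -> G) -> M) g :
  cobd (fun x => f x - h x) g = cobd f g - cobd h g.
Proof. by rewrite /cobd -sumrB; apply: eq_bigr => i _; rewrite scalerBr. Qed.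

(* By [cobd_fcons], [cobd \o cobd] commutes with [f |-> f \o fcons x]. *)
Lemma cobd_cobd n (f : ('I_n -> G) -> M) g : cobd (cobd f) g = 0.
Proof.
elim: n f g => [|n IH] f g.
  rewrite /cobd !big_ord_recl !big_ord0 /= !addr0 expr1 expr0 !scale1r scaleN1r.
  by apply/eqP; rewrite subr_eq0; apply/eqP; congr f; apply/funext; case.
rewrite (fcons_eta g) cobd_fcons.
under [X in _ - cobd X _]funext => h do rewrite cobd_fcons.
by rewrite cobdB IH subr0 subrr.
Qed.

Lemma cobd_cochain n (f : ('I_n.+1 -> G) -> M) : cochain f ->
  cochain (coboundary f).
Proof.
move=> fP h g; rewrite /coboundary scaler_sumr; apply: eq_bigr => i _.
by rewrite fP !scalerA commr_sign.
Qed.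

Lemma cochainB n (f h : ('I_n.+1 -> G) -> M) : cochain f -> cochain h ->
  cochain (fun g => f g - h g).
Proof. by move=> fP hP k g; rewrite fP hP scalerBr. Qed.

Lemma QG_ofM (x y : G) : QG_of (x * y)%g = QG_of x * QG_of y.
Proof.
apply/val_inj/funext => g; rewrite /= conv_monomiall mul1r /monomial.
by rewrite -(inj_eq (mulgI x) (x^-1 * g)%g) mulVKg.
Qed.

Lemma QG_of1 : QG_of (1%g : G) = 1.
Proof. exact: val_inj. Qed.

(** $G$ acts freely on tuples: choose values at tuples with first entry 1 and translate them. *)
Lemma cochain_choice n (T : ('I_n.+1 -> G) -> M -> Prop) :
  (forall g, exists m, T g m) ->
  (forall h g m, T g m -> T (fun i => h * g i)%g (QG_of h *: m)) ->
  exists2 c, cochain c & forall g, T g (c g).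
Proof.
move=> Ttot Teq; have [s sP] := choice Ttot.
exists (fun g => QG_of (g ord0) *: s (fun i => (g ord0)^-1 * g i)%g) => [h g|g].
  rewrite scalerA -QG_ofM; congr (_ *: s _); apply/funext => i.
  by rewrite invgM -mulgA mulKg.
have := Teq (g ord0) _ _ (sP (fun i => (g ord0)^-1 * g i)%g).
by congr T; apply/funext => i; rewrite mulVKg.
Qed.

End Cobd.

Lemma linear_cobd (M N : lmodType (QG G)) (u : {linear M -> N}) n
    (f : ('I_n -> G) -> M) g : u (cobd f g) = cobd (u \o f) g.
Proof. by rewrite linear_sum; apply: eq_bigr => i _; rewrite linearZ. Qed.

Lemma linear_cochain (M N : lmodType (QG G)) (u : {linear M -> N}) n
    (f : ('I_n.+1 -> G) -> M) : cochain f -> cochain (u \o f).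
Proof. by move=> fP h g; rewrite /= fP linearZ. Qed.

End BarComplex.

(** * Translation modules *)

Section GroupRingMonomials.
Variable G : groupType.

Definition mono (g : G) (r : rat) : QG G :=
  Series (monomial_series (finite_supports G) (I : full_pieces G g r)).

Lemma mono_supp g r : supp (mono g r) `<=` [set g].
Proof.
by move=> h; rewrite /supp /= /monomial; have [->|_] := eqVneq h g; rewrite ?eqxx.
Qed.

Lemma monoM g h r s : mono g r * mono h s = mono (g * h)%g (r * s).
Proof.
apply/val_inj/funext => k; rewrite /= conv_monomiall /monomial.
by rewrite -(inj_eq (mulgI g) (g^-1 * k)%g) mulVKg; case: ifP; rewrite ?mulr0.
Qed.

Lemma monoD g r s : mono g (r + s) = mono g r + mono g s.
Proof.
apply/val_inj/funext => k; rewrite -[RHS]/(mono g r k + mono g s k) /= /monomial.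
by case: ifP; rewrite ?addr0.
Qed.

Lemma QG_fin (a : QG G) : finite_set (supp a).
Proof. exact: (series_supp a : finite_set _). Qed.

Lemma QG_ind (T : QG G -> Prop) : T 0 -> (forall a b, T a -> T b -> T (a + b)) ->
  (forall g r, T (mono g r)) -> forall a, T a.
Proof.
move=> T0 TD Tm a.
have -> : a = \sum_(g <- fset_set (supp a)) mono g (a g).
  apply/val_inj/funext => k.
  have ev (r : seq G) (F : G -> QG G) : (\sum_(g <- r) F g) k = \sum_(g <- r) F g k.
    by elim/big_rec2: _ => [//|i x y _ <-]; rewrite seriesD.
  apply: etrans _ (esym (ev _ _)); rewrite -[LHS]/(a k).
  have fin := QG_fin a.
  rewrite -(@sum_on _ _ (fun g => mono g (a g) k) _ fin) => [|i].
    rewrite (@sum_single _ _ _ k) /= /monomial ?eqxx// => j.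
    by rewrite eq_sym => /negPf->.
  by rewrite /supp /= /monomial; case: (k == i) => //; rewrite eqxx.
by elim/big_rec: _ => // g x _; exact: TD.
Qed.

Lemma QG_linear (M N : lmodType (QG G)) (f : M -> N) :
  {morph f : x y / x + y} -> (forall g r x, f (mono g r *: x) = mono g r *: f x) ->
  linear f.
Proof.
move=> fD fm a x y; rewrite fD; congr (_ + _).
have f0 : f 0 = 0 by apply: (addrI (f 0)); rewrite -fD !addr0.
elim/QG_ind: a => [|a b Ha Hb|g r]; first by rewrite !scale0r.
  by rewrite !scalerDl fD Ha Hb.
exact: fm.
Qed.

Section SubmoduleOfMono.
Variables (M : lmodType (QG G)) (S : M -> Prop).
Hypotheses (S0 : S 0) (SD : forall x y, S x -> S y -> S (x + y)).
Hypothesis Sm : forall g r x, S x -> S (mono g r *: x).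

Fact mono_sm_lin a x y : S x -> S y -> S (a *: x + y).
Proof.
move=> Sx Sy; apply: SD => //; elim/QG_ind: a => [|a b Ha Hb|g r].
- by rewrite scale0r.
- by rewrite scalerDl; exact: SD.
- exact: Sm.
Qed.

Definition mono_submodule := Submodule S0 mono_sm_lin.
End SubmoduleOfMono.

(** An alias, so that the rational structure does not clash with the $\mathbb{Q}G$-structure on the
    same type. *)
Definition rat_module (M : lmodType (QG G)) : Type := M.

Section RatModule.
Variable M : lmodType (QG G).
HB.instance Definition _ := GRing.Zmodule.copy (rat_module M) M.

Definition rat_scale (r : rat) (v : rat_module M) : rat_module M :=
  mono 1%g r *: (v : M).

Fact rat_scaleA a b v : rat_scale a (rat_scale b v) = rat_scale (a * b) v.
Proof. by rewrite /rat_scale scalerA monoM mul1g. Qed.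
Fact rat_scale1 : left_id 1 rat_scale.
Proof. by move=> v; rewrite -[RHS]scale1r; congr (_ *: _); exact: val_inj. Qed.
Fact rat_scaleDr : right_distributive rat_scale +%R.
Proof. by move=> a u v; rewrite /rat_scale scalerDr. Qed.
Fact rat_scaleDl v : {morph rat_scale^~ v : a b / a + b}.
Proof. by move=> a b; rewrite /rat_scale monoD scalerDl. Qed.

HB.instance Definition _ := GRing.Zmodule_isLmodule.Build rat (rat_module M)
  rat_scaleA rat_scale1 rat_scaleDr rat_scaleDl.
End RatModule.

(** The module coinduced from the trivial subgroup, $G$ acting by right translation. It provides the
    modules for dimension shifting and contains $\mathrm{CoInd}_N^G M$. *)
Definition translation_module (V : lmodType rat) : Type := G -> V.

Section TranslationModule.
Variable V : lmodType rat.
HB.instance Definition _ := GRing.Zmodule.copy (translation_module V) (G -> V).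

Definition translate (a : QG G) (f : translation_module V) :
    translation_module V :=
  fun x => \sum_(g \in [set: G]) a g *: f (x * g)%g.

Lemma translateE (X : set G) (a : QG G) f x : finite_set X -> supp a `<=` X ->
  translate a f x = \sum_(g <- fset_set X) a g *: f (x * g)%g.
Proof.
move=> finX aX; apply: sum_on => // g ag; apply: aX.
by apply: contra_neq ag => ->; rewrite scale0r.
Qed.

Lemma translate_mono g r f x : translate (mono g r) f x = r *: f (x * g)%g.
Proof.
rewrite (translateE _ _ (finite_set1 g) (@mono_supp g r)) fset_set1.
by rewrite big_seq_fset1 /= /monomial eqxx.
Qed.

Lemma translateD (a b : QG G) f x :
  translate (a + b) f x = translate a f x + translate b f x.
Proof.
pose X := supp a `|` supp b.
have finX : finite_set X by rewrite finite_setU; split; exact: QG_fin.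
rewrite !(translateE _ _ finX); [|by right|by left|].
  by rewrite -big_split; apply: eq_bigr => g _; rewrite seriesD scalerDl.
move=> g; rewrite /supp /= -[X in X != 0]/(a g + b g) => abg.
have [ag|] := eqVneq (a g) 0.
  by right; rewrite /supp /=; apply: contra_neq abg => ->; rewrite ag addr0.
by left.
Qed.

Fact translateDr : right_distributive translate +%R.
Proof.
move=> a f h; apply/funext => x.
rewrite -[RHS]/(translate a f x + translate a h x).
have finX := QG_fin a.
rewrite !(translateE _ _ finX)// -big_split.
by apply: eq_bigr => g _; exact: scalerDr.
Qed.

Fact translateDl f : {morph translate^~ f : a b / a + b}.
Proof. by move=> a b; apply/funext => x; exact: translateD. Qed.

Fact translateA a b f : translate a (translate b f) = translate (a * b) f.
Proof.
have t0 f' : translate 0 f' = 0.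
  by apply: (addrI (translate 0 f')); rewrite -translateDl !addr0.
have tr0 a' : translate a' 0 = 0.
  by apply: (addrI (translate a' 0)); rewrite -translateDr !addr0.
elim/QG_ind: a => [|a a' Ha Ha'|g r]; first by rewrite mul0r !t0.
  by rewrite mulrDl !translateDl Ha Ha'.
elim/QG_ind: b => [|b b' Hb Hb'|h s]; first by rewrite mulr0 !t0 tr0.
  by rewrite mulrDr !translateDl translateDr Hb Hb'.
by apply/funext => x; rewrite monoM !translate_mono scalerA mulgA.
Qed.

Fact translate1 : left_id 1 translate.
Proof.
move=> f; apply/funext => x; rewrite (_ : 1 = mono 1%g 1); last exact: val_inj.
by rewrite translate_mono scale1r mulg1.
Qed.

HB.instance Definition _ := GRing.Zmodule_isLmodule.Build (QG G)
  (translation_module V) translateA translate1 translateDr translateDl.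

Lemma monoZ_apply g r (f : translation_module V) x :
  (mono g r *: f) x = r *: f (x * g)%g.
Proof. exact: translate_mono. Qed.

Lemma QG_ofZ_apply g (f : translation_module V) x :
  (QG_of g *: f) x = f (x * g)%g.
Proof. by rewrite -[QG_of g]/(mono g 1) monoZ_apply scale1r. Qed.
End TranslationModule.

Lemma translation_sum (V : lmodType rat) I (r : seq I) (F : I -> translation_module V) x :
  (\sum_(i <- r) F i) x = \sum_(i <- r) F i x.
Proof. by elim/big_rec2: _ => [//|i a b _ <-]. Qed.

Section Embedding.
Variable J : lmodType (QG G).
(** The canonical embedding of $J$ in the module coinduced from its underlying rational vector
    space; evaluation at 1 is a left inverse. *)
Definition orbit_map (j : J) : translation_module (rat_module J) :=
  fun x => (QG_of x *: j : J).

Fact orbit_map_linear : linear orbit_map.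
Proof.
apply: QG_linear => [i j|g r j]; apply/funext => x.
  by rewrite /orbit_map scalerDr.
rewrite monoZ_apply /orbit_map.
rewrite -[_ *: (_ : rat_module J)]/(mono 1%g r *: (QG_of (x * g)%g *: j)).
rewrite !scalerA -[QG_of x]/(mono x 1) -[QG_of (x * g)%g]/(mono (x * g)%g 1).
by rewrite !monoM mul1g mul1r mulr1.
Qed.
End Embedding.

End GroupRingMonomials.

(** * Comparison with a projective resolution *)

Section CobdLemmas.
Variable G : groupType.

Lemma cobd_sm (M : lmodType (QG G)) (B : submodule M) n (f : ('I_n -> G) -> M) g :
  (forall g, B (f g)) -> B (cobd f g).
Proof. by move=> Bf; apply: sm_sum => i; exact: smZ. Qed.

Lemma sign_apply (V : lmodType rat) i (f : translation_module G V) x :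
  ((-1) ^+ i *: f) x = (-1) ^+ i *: f x.
Proof.
by rewrite -signr_odd -[in RHS]signr_odd; case: odd;
  rewrite ?expr1 ?expr0 ?scaleN1r ?scale1r.
Qed.

Lemma cobd_apply (V : lmodType rat) n (f : ('I_n -> G) -> translation_module G V) g x :
  cobd f g x = \sum_(i < n.+1) (-1) ^+ i *: f (fun j => g (lift i j)) x.
Proof. by rewrite /cobd translation_sum; apply: eq_bigr => i _; rewrite sign_apply. Qed.

Lemma rat_sign (M : lmodType (QG G)) i (v : M) :
  (-1) ^+ i *: (v : rat_module M) = (-1) ^+ i *: v.
Proof.
by rewrite -signr_odd -[in RHS]signr_odd; case: odd;
  rewrite ?expr1 ?expr0 ?scaleN1r ?scale1r.
Qed.

Lemma augmentation_mono (g : G) r : augmentation (mono g r) = r.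
Proof.
rewrite /augmentation (@sum_single _ _ _ g) /= /monomial ?eqxx// => j.
by move=> /negPf->.
Qed.

(** Being a coboundary with values in $J/B$, written in $J$. By freeness of the action on tuples, a
    cochain in $J/B$ lifts to an equivariant [e] in $J$. *)
Definition relative_coboundary (J : lmodType (QG G)) (B : J -> Prop) n :
    (('I_n.+1 -> G) -> J) -> Prop :=
  match n with
  | 0 => fun f => forall g, B (f g)
  | m.+1 => fun f => exists2 e : ('I_m.+1 -> G) -> J,
      cochain e & forall g, B (f g - coboundary e g)
  end.

Lemma relative_coboundary_cocycle (J : lmodType (QG G)) (B : J -> Prop) n f :
  relative_coboundary B f -> exists D : ('I_n.+1 -> G) -> J,
    [/\ cochain D, forall g, cobd D g = 0 & forall g, B (f g - D g)].
Proof.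
case: n f => [|n] f /=.
  move=> Bf; exists (fun=> 0); split=> [h g|g|g]; rewrite ?scaler0 ?subr0//.
  by apply: big1 => i _; rewrite scaler0.
move=> [e eP Bf]; exists (coboundary e); split=> //; first exact: cobd_cochain.
by move=> g; exact: cobd_cobd.
Qed.

End CobdLemmas.

Section Coinduced.
Variables (G : groupType) (J : lmodType (QG G)) (B : submodule J).
Notation J' := (translation_module G (rat_module J)).

Definition pointwise_submodule : submodule J'.
Proof.
apply: (@mono_submodule G J' (fun f => forall x, B (f x))) => [x|f h Bf Bh x|g r f Bf x].
- exact: sm_0.
- exact: smD.
- by rewrite monoZ_apply; exact: smZ.
Defined.

Definition orbit_linear : {linear J -> J'} := linear_pack (@orbit_map_linear G J).

(** The sum of [pointwise_submodule] and the image of $J$: the quotient of $J'$ by it is the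
    cokernel of $J/B \to J'/B'$. *)
Definition orbit_submodule : submodule J'.
Proof.
exists (fun f => exists j, pointwise_submodule (f - orbit_linear j)).
  by exists 0; rewrite linear0 subrr; exact: sm_0.
move=> a f h [j fj] [k hk]; exists (a *: j + k).
by rewrite linearP opprD addrACA -scalerBr; exact: sm_lin.
Defined.

(** Injectivity of $J/B \to J'/B'$, seen by evaluating at 1. *)
Lemma orbit_pointwise j : pointwise_submodule (orbit_linear j) -> B j.
Proof. by move=> /(_ 1%g); rewrite /= /linear_of /orbit_map QG_of1 scale1r. Qed.

(** The homotopy that inserts 1 in front, made equivariant by first translating the tuple by the
    argument [x] of the function. *)
Definition contraction n (f : ('I_n.+1 -> G) -> J) (g : 'I_n -> G) : J' :=
  fun x => f (fcons 1%g (fun i => x * g i)%g).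

Lemma contraction_cochain n (f : ('I_n.+2 -> G) -> J) : cochain (contraction f).
Proof.
move=> h g; apply/funext => x; rewrite QG_ofZ_apply; congr (f (fcons _ _)).
by apply/funext => i; rewrite mulgA.
Qed.

(** A cocycle of $J/B$ becomes a coboundary in $J'/B'$: this is [cobd_fcons] with first entry 1. *)
Lemma contraction_homotopy n (f : ('I_n.+1 -> G) -> J) g :
  cochain f -> (forall g, B (cobd f g)) ->
  pointwise_submodule (orbit_linear (f g) - cobd (contraction f) g).
Proof.
move=> fP Bf x; rewrite -[X in B X]/(QG_of x *: f g - cobd (contraction f) g x).
rewrite cobd_apply -fP.
have -> : f (fun i => x * g i)%g = cobd f (fcons 1%g (fun i => x * g i)%g) +
    cobd (fun h => f (fcons 1%g h)) (fun i => x * g i)%g.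
  by rewrite cobd_fcons subrK.
rewrite (_ : \sum_(i < _) _ = cobd (fun h => f (fcons 1%g h)) (fun i => x * g i)%g).
  by rewrite addrK.
by apply: eq_bigr => i _; rewrite rat_sign.
Qed.

End Coinduced.

Section Comparison.
Variables (G : groupType) (P : nat -> lmodType (QG G)).
Variables (dd : forall i, {linear P i.+1 -> P i}) (eps : {linear P 0%N -> trivial_QG G}).
Hypothesis Pproj : forall i, projective (P i).
Hypothesis eps_surj : forall v, exists x, eps x = v.
Hypothesis eps_exact : forall x, eps x = 0 <-> exists y, dd 0%N y = x.
Hypothesis dd_exact : forall i x, dd i x = 0 <-> exists y, dd i.+1 y = x.

(* [tau] is a component of a chain map from the bar resolution to [P]. The    *)
(* last clause says that every class in H^n(G; J / B) is the image of the     *)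
(* universal class [tau]; stating it for pairs [B <= J] avoids quotient       *)
(* modules.                                                                   *)
Definition comparison n (tau : ('I_n.+1 -> G) -> P n) : Prop :=
  [/\ cochain tau, forall g, exists y, dd n y = coboundary tau g &
   forall (J : lmodType (QG G)) (B : submodule J) (f : ('I_n.+1 -> G) -> J),
     cochain f -> (forall g, B (coboundary f g)) ->
     exists th : {linear P n -> J}, (forall y, B (th (dd n y))) /\
       relative_coboundary B (fun g => f g - th (tau g))].

Lemma comparison0 : exists tau, @comparison 0 tau.
Proof.
have [||tau tauP tau1] := @cochain_choice G (P 0%N) 0 (fun _ m => eps m = (1 : rat)).
- by move=> _; exact: eps_surj.
- move=> h _ m m1; rewrite linearZ m1 -[LHS]/(augmentation (mono h 1) * 1).
  by rewrite augmentation_mono mulr1.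
exists tau; split=> // [g|J B f fP Bf].
  apply/eps_exact; rewrite -[coboundary _ _]/(cobd tau g) linear_cobd /cobd.
  rewrite !big_ord_recl big_ord0 /= !tau1 expr1 expr0 scale1r scaleN1r addr0.
  by rewrite subrr.
(* A 0-cocycle modulo [B] is constant modulo [B], so its value [b] is $G$-invariant modulo [B]. *)
pose b := f (fun=> 1%g).
have fb g : B (f g - b).
  have := Bf (fcons 1%g g); rewrite -[coboundary _ _]/(cobd f _) cobd_fcons.
  rewrite /cobd big_ord_recl big_ord0 addr0 expr0 scale1r.
  rewrite (_ : fcons 1%g _ = fun=> 1%g)//.
  by apply/funext => i; rewrite (ord1 i); exact: fcons0.
have gb g : B (QG_of g *: b - b) by rewrite -fP.
(* [mono 1%g r] is the rational number [r]; modulo [B], the element [a] acts on [b] through its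
   augmentation. *)
have ab a r : B ((a * mono 1%g r) *: b - mono 1%g (augmentation a * r) *: b).
  elim/QG_ind: a => [|a a' Ha Ha'|g s].
  - rewrite mul0r scale0r sub0r; apply: smN.
    rewrite (_ : mono _ _ = 0) ?scale0r; first exact: sm_0.
    apply/val_inj/funext => g; rewrite /= /monomial.
    by rewrite /augmentation fsbig1 ?mul0r//; case: ifP.
  - rewrite mulrDl scalerDl augmentationD mulrDl monoD scalerDl opprD addrACA.
    exact: smD.
  - rewrite monoM mulg1 augmentation_mono.
    have -> : mono g (s * r) = mono 1%g (s * r) * QG_of g.
      by rewrite -[QG_of g]/(mono g 1) monoM mul1g mulr1.
    by rewrite -scalerA -scalerBr; exact: smZ.
(* The map sought is [eps] followed by multiplication of [b], lifted from $J/B$ to $J$. *)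
have [||a p j q k pj qk|th thP] := @projective_selection _ (P 0%N) J
    (fun p j => B (j - mono 1%g (eps p) *: b)) (@Pproj 0%N).
- by move=> p; exists (mono 1%g (eps p) *: b); rewrite subrr; exact: sm_0.
- rewrite linear0 sub0r; apply: smN.
  rewrite (_ : mono _ _ = 0) ?scale0r; first exact: sm_0.
  by apply/val_inj/funext => g; rewrite /= /monomial; case: ifP.
- rewrite linearP.
  rewrite -[(_ *: _ + _ : trivial_QG G)]/(augmentation a * (eps p : rat) + (eps q : rat)).
  have -> : a *: j + k - mono 1%g (augmentation a * (eps p : rat) + (eps q : rat)) *: b =
     a *: (j - mono 1%g (eps p) *: b) + (k - mono 1%g (eps q) *: b) +
     ((a * mono 1%g (eps p)) *: b - mono 1%g (augmentation a * (eps p : rat)) *: b).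
    rewrite monoD scalerDl scalerBr scalerA.
    by rewrite [RHS]addrAC subrKA addrACA -opprD.
  by apply: smD => //; exact: sm_lin.
exists th; split=> [y|g].
  have /eps_exact y0 : exists z, dd 0 z = dd 0 y by exists y.
  have := thP (dd 0 y); rewrite y0 (_ : mono _ _ = 0) ?scale0r ?subr0//.
  by apply/val_inj/funext => g; rewrite /= /monomial; case: ifP.
have := thP (tau g); rewrite tau1 => t1; have := smB (fb g) t1.
rewrite -[mono 1%g _]/(QG_of 1%g) QG_of1 scale1r opprB addrA subrK.
by [].
Qed.

(* Dimension shifting: [J / B] embeds in the acyclic [J' / B'], with [J'] the *)
(* functions [G -> J] and [B'] the functions [G -> B].                        *)
Lemma comparisonS n tau : @comparison n tau -> exists tau', @comparison n.+1 tau'.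
Proof.
move=> [tauP dtau tauU].
have [||tau' tau'P dtau'] :=
  @cochain_choice G (P n.+1) n.+1 (fun g m => dd n m = coboundary tau g).
- exact: dtau.
- move=> h g m mE.
  by rewrite linearZ mE (cobd_cochain tauP).
exists tau'; split=> // [g|J B f fP Bf].
  apply/dd_exact; rewrite -[coboundary _ _]/(cobd tau' g) linear_cobd.
  rewrite (_ : dd n \o tau' = cobd tau); first exact: cobd_cobd.
  by apply/funext => h; exact: dtau'.
pose i := orbit_linear J; pose B' := pointwise_submodule B.
pose F := contraction f.
have FP : cochain F := contraction_cochain f.
have fF g : B' (i (f g) - coboundary F g) := contraction_homotopy g fP Bf.
(* [F] is a cocycle modulo the larger submodule because its coboundary agrees with [i \o f] modulo
   [B']. *)
have [|th [thd]] := tauU _ (orbit_submodule B) F FP.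
  by move=> g; exists (f g); rewrite -opprB; apply: smN; exact: fF.
(* Replacing the coboundary by a cocycle [D] treats degree 0 and positive degrees alike. The rest of
   [F] has the form [i \o b] modulo [B']. *)
move=> /relative_coboundary_cocycle[D [DP D0 DF]].
have [|h g j|b bP bE] :=
  @cochain_choice G J n (fun g j => B' (F g - th (tau g) - D g - i j)).
- exact: DF.
- move=> Bj; rewrite FP tauP DP (linearZZ th) (linearZZ i) -!scalerBr; exact: smZ.
(* [th \o dd n] lands in the image of [i] modulo [B']; [th'] lifts it to $J$ and represents the
   image of [th] under the connecting map. *)
have [||a p j q k pj qk|th' th'P] := @projective_selection _ (P n.+1) J
    (fun p j => B' (th (dd n p) - i j)) (@Pproj n.+1).
- exact: thd.
- by rewrite !linear0 addr0; exact: sm_0.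
- by rewrite (linearP (dd n)) (linearP th) (linearP i) opprD addrACA -scalerBr;
    exact: sm_lin.
exists th'; split=> [y|].
  have /dd_exact y0 : exists z, dd n.+1 z = dd n.+1 y by exists y.
  have := th'P (dd n.+1 y); rewrite y0 linear0 sub0r => /smN; rewrite opprK.
  exact: orbit_pointwise.
exists b => // g; apply: orbit_pointwise.
have dB : B' (cobd F g - th (cobd tau g) - i (cobd b g)).
  have := cobd_sm g bE.
  rewrite (cobdB (fun g => F g - th (tau g) - D g) (fun g => i (b g))).
  rewrite (cobdB (fun g => F g - th (tau g)) D) (cobdB F (fun g => th (tau g))).
  by rewrite D0 subr0 (linear_cobd th) (linear_cobd i).
have zmodE (U : zmodType) (u v w x y : U) :
    u - v + (v - w - x) + (w - y) = u - y - x.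
  by rewrite -(addrA v) subrKA (addrA u) [LHS]addrAC subrKA.
(* Adding the three congruences cancels [coboundary F g] and [th (coboundary tau g)], leaving [i] of
   the required difference. *)
have := smD (smD (fF g) dB) (th'P (tau' g)).
by rewrite dtau' zmodE -!(linearB i).
Qed.

Lemma comparison_exists n : exists tau, @comparison n tau.
Proof. by elim: n => [|n [tau /comparisonS]]; [exact: comparison0|]. Qed.

End Comparison.

(** * Covers by acyclic modules, Shapiro's lemma *)

Section VanishingCohomology.
Variable G : groupType.

Lemma is_coboundary_linear (M N : lmodType (QG G)) (u : {linear M -> N}) n
    (f : ('I_n.+1 -> G) -> M) : is_coboundary f -> is_coboundary (u \o f).
Proof.
case: n f => [|n] f /=; first by move=> f0 g; rewrite f0 linear0.
move=> [e eP fe]; exists (u \o e); first exact: linear_cochain.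
by move=> g; rewrite fe; exact: linear_cobd.
Qed.

Lemma is_coboundaryD (M : lmodType (QG G)) n (f h : ('I_n.+1 -> G) -> M) :
  is_coboundary (fun g => f g - h g) -> is_coboundary h -> is_coboundary f.
Proof.
case: n f h => [|n] f h /=; first by move=> fh h0 g; have := fh g; rewrite h0 subr0.
move=> [e eP fe] [k kP hk]; exists (fun g => e g + k g).
  by move=> x g; rewrite eP kP scalerDr.
move=> g; rewrite -[LHS](subrK (h g)) fe hk -big_split.
by apply: eq_bigr => i _; rewrite scalerDr.
Qed.

(** Right exactness on cochains. The coboundary of [F] is a cocycle in the kernel of [psi], hence
    the coboundary of some [e] there. Then [F - e] is a cocycle in [A], so a coboundary, and [psi]
    sends it to [psi \o F]. *)
Lemma is_coboundary_lift (A B : lmodType (QG G)) (psi : {linear A -> B}) n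
    (F : ('I_n.+1 -> G) -> A) :
  cohomology_zero (sm_type (sm_ker psi)) n.+1 -> cohomology_zero A n ->
  cochain F -> (forall g, coboundary (psi \o F) g = 0) -> is_coboundary (psi \o F).
Proof.
move=> Hker HA FP dF.
have kerF g : sm_ker psi (coboundary F g).
  by rewrite /= -[coboundary _ _]/(cobd F g) linear_cobd; exact: dF.
pose k g := sm_of (kerF g).
have [|e eP ke] := Hker k.
  split=> [h g|g]; apply: val_inj; first by rewrite linearZ /= (cobd_cochain FP).
  by rewrite -[coboundary _ _]/(cobd k g) linear_cobd linear0; exact: cobd_cobd.
have eF g : coboundary F g = cobd (\val \o e) g.
  by rewrite -linear_cobd -[LHS]/(val (k g)) ke.
have /(is_coboundary_linear psi) : is_coboundary (fun g => F g - val (e g)).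
  apply: HA; split=> [|g].
    by apply: cochainB => // h g; rewrite eP linearZ.
  by rewrite -[LHS]/(cobd _ g) cobdB -[cobd F g]/(coboundary F g) eF subrr.
congr is_coboundary; apply/funext => g; rewrite /= linearB.
by rewrite (_ : psi (val (e g)) = 0) ?subr0//; exact: (sm_valP (e g)).
Qed.

Lemma cohomology_zero_prod (A B : lmodType (QG G)) n :
  cohomology_zero A n -> cohomology_zero B n ->
  cohomology_zero (A * B)%type n.
Proof.
move=> HA HB f [fP df].
have l1 : linear (fst : A * B -> A) by [].
have l2 : linear (snd : A * B -> B) by [].
have f1 : is_coboundary (linear_pack l1 \o f).
  apply: HA; split; first exact: linear_cochain.
  by move=> g; rewrite -[LHS]/(cobd _ g) -linear_cobd -[cobd _ _]/(coboundary f g) df.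
have f2 : is_coboundary (linear_pack l2 \o f).
  apply: HB; split; first exact: linear_cochain.
  by move=> g; rewrite -[LHS]/(cobd _ g) -linear_cobd -[cobd _ _]/(coboundary f g) df.
case: n f fP df f1 f2 {HA HB} => [|n] f fP df /=.
  by move=> f1 f2 g; rewrite [f g]surjective_pairing; congr pair; [exact: f1|exact: f2].
move=> [e eP fe] [k kP fk]; exists (fun g => (e g, k g)).
  by move=> h g; rewrite eP kP.
move=> g; rewrite [f g]surjective_pairing -[coboundary _ _]/(cobd _ g).
rewrite [cobd _ _]surjective_pairing; congr pair.
  by rewrite -[RHS]/(linear_pack l1 _) linear_cobd; exact: fe.
by rewrite -[RHS]/(linear_pack l2 _) linear_cobd; exact: fk.
Qed.

(** The map [psi] need only hit the listed elements, not be onto; this is where finite generation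
    enters. *)
Definition acyclic_cover (B : lmodType (QG G)) n (s : seq B) : Prop :=
  exists (A : lmodType (QG G)) (psi : {linear A -> B}),
    cohomology_zero A n /\ forall x, x \in s -> exists a, psi a = x.

Lemma acyclic_cover_cat (B : lmodType (QG G)) n (s t : seq B) :
  acyclic_cover n s -> acyclic_cover n t -> acyclic_cover n (s ++ t).
Proof.
move=> [A [u [HA us]]] [A' [v [HA' vt]]].
have l : linear (fun x : A * A' => u x.1 + v x.2).
  by move=> a x y; rewrite !linearP scalerDr addrACA.
exists (A * A')%type, (linear_pack l); split; first exact: cohomology_zero_prod.
move=> x; rewrite mem_cat => /orP[/us[a <-]|/vt[a <-]].
  by exists (a, 0); rewrite /= /linear_of linear0 addr0.
by exists (0, a); rewrite /= /linear_of linear0 add0r.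
Qed.

Lemma acyclic_cover_sum (B : lmodType (QG G)) n (s : seq B) :
  acyclic_cover n s -> acyclic_cover n [:: \sum_(x <- s) x].
Proof.
move=> [A [u [HA us]]]; exists A, u; split=> // _ /[!inE]/eqP->.
elim: s us => [|x s IH] us; first by exists 0; rewrite linear0 big_nil.
have [|a ua] := IH; first by move=> y ys; apply: us; rewrite inE ys orbT.
have [|b ub] := us x; first exact: mem_head.
by exists (b + a); rewrite linearD big_cons ua ub.
Qed.

Lemma acyclic_cover_nil (B : lmodType (QG G)) n : acyclic_cover n ([::] : seq B).
Proof.
have l : linear (\val : sm_type (sm_zero B) -> B) by exact: linearP.
exists (sm_type (sm_zero B)), (linear_pack l); split=> //.
have Z (x y : sm_type (sm_zero B)) : x = y.
  by apply: val_inj; rewrite (sm_valP x) (sm_valP y).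
case: n => [|n] f _ /= => [g|]; first exact: Z.
by exists (fun=> 0) => [h g|g]; exact: Z.
Qed.

Lemma acyclic_cover_all (B : lmodType (QG G)) n (s : seq B) :
  (forall x, x \in s -> acyclic_cover n [:: x]) -> acyclic_cover n s.
Proof.
elim: s => [|x s IH] cov; first exact: acyclic_cover_nil.
apply: (acyclic_cover_cat (cov x (mem_head _ _))); apply: IH => y ys.
by apply: cov; rewrite inE ys orbT.
Qed.

(** Up to a coboundary [f] is [th \o tau]. An acyclic cover of the images of the generators of [P n]
    has image containing that of [th], so projectivity lifts [th] to the acyclic module and right
    exactness applies. *)
Lemma vanishing_of_acyclic_covers (B : lmodType (QG G)) n : type_FPQ G ->
  (forall K : lmodType (QG G), cohomology_zero K n.+1) ->
  (forall s : seq B, acyclic_cover n s) -> cohomology_zero B n.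
Proof.
move=> [L [P [dd [eps [Pfgp _ eps_surj eps_ex dd_ex]]]]] Htop cov f [fP df].
have Pproj i : projective (P i) by case: (Pfgp i).
have [tau [tauP dtau tauU]] := comparison_exists Pproj eps_surj eps_ex dd_ex n.
(* Over the zero submodule the comparison is absolute: [th \o dd n] vanishes. *)
have [th [thd fth]] := tauU B (sm_zero B) f fP df.
apply: (@is_coboundaryD _ _ f (th \o tau)) => //.
  case: n f fP df tau tauP dtau th {tauU Htop cov} thd fth
    => [|n] f fP df tau tauP dtau th thd //=.
  by move=> [e eP fe]; exists e => // g; apply/eqP; rewrite -subr_eq0 fe.
have [_ [r [e eP]]] := Pfgp n.
have [A [psi [HA psis]]] := cov [seq th (e i) | i <- enum 'I_r].
have [||a p j q k pj qk|th' th'P] :=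
  @projective_selection _ (P n) A (fun p a => psi a = th p) (Pproj n).
- move=> p; have [a ->] := eP p.
  have [|b bP] := choice (_ : forall i, exists x, psi x = th (e i)).
    by move=> i; apply: psis; apply: map_f; rewrite mem_enum.
  exists (\sum_(i < r) a i *: b i); rewrite !linear_sum.
  by apply: eq_bigr => i _; rewrite !linearZ bP.
- by rewrite !linear0.
- by rewrite !linearP pj qk.
have -> : th \o tau = psi \o (th' \o tau).
  by apply/funext => g; rewrite /= th'P.
apply: is_coboundary_lift => //; first exact: linear_cochain.
move=> g; rewrite (_ : psi \o _ = th \o tau); last first.
  by apply/funext => h; rewrite /= th'P.
rewrite -[LHS]/(cobd _ g) -linear_cobd -[cobd _ _]/(coboundary tau g).
by have [y <-] := dtau g; exact: thd.
Qed.

End VanishingCohomology.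

Section Shapiro.
Variables (G : groupType) (N : normalSubgroup G).
Variable M : lmodType (QG (subgroup_of N)).
Notation T := (translation_module G (rat_module M)).

Lemma rat_scale_comm r (n : subgroup_of N) (v : rat_module M) :
  r *: (QG_of n *: (v : M) : rat_module M) = (QG_of n *: (r *: v : M) : M).
Proof.
rewrite -[LHS]/(mono 1%g r *: (QG_of n *: (v : M))) -[r *: v]/(mono 1%g r *: (v : M)).
by rewrite !scalerA -[QG_of n]/(mono n 1) !monoM mul1g mulg1 mulr1 mul1r.
Qed.

(** $\mathrm{CoInd}_N^G M$: left translation by $N$ is matched with the action on $M$, while $G$
    acts by right translation. *)
Definition coinduced : submodule T.
Proof.
apply: (@mono_submodule G T (fun f => forall (n : subgroup_of N) x,
    f (val n * x)%g = QG_of n *: (f x : M))) => [n x|f h fN hN n x|g r f fN n x].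
- by rewrite scaler0.
- rewrite -[LHS]/(f _ + h _) fN hN; exact: esym (@scalerDr _ M _ (f x) (h x)).
- by rewrite !monoZ_apply -mulgA fN rat_scale_comm.
Defined.

Let rep x := lift_of (qproj N x).

(* The factor [rep 1] makes the [N]-equivariant map [retraction] the identity *)
(* on [N].                                                                    *)
Fact retraction_mem x : (x * (rep x)^-1 * rep 1)%g \in ns_pred N.
Proof.
apply/qproj_eq1; rewrite !qprojM /rep lift_ofK (qproj_eq1 _ 1%g).2 ?ns1//.
rewrite mulg1; have [k Nk ->] := lift_of_qproj N x.
rewrite -qprojM invgM mulgA; apply/qproj_eq1.
rewrite -mulgA -/(conjg _ _) -[X in (X * _)%g]invgK.
by apply: ns_conj; exact: nsV.
Qed.

Definition retraction x : subgroup_of N :=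
  exist (fun y => y \in ns_pred N) _ (retraction_mem x).

Lemma retractionM (n : subgroup_of N) x :
  retraction (val n * x)%g = (n * retraction x)%g.
Proof.
apply: val_inj; rewrite /= /rep qprojM (qproj_eq1 _ (val n)).2 ?mul1g ?mulgA//.
exact: (valP n).
Qed.

Lemma retraction_val (n : subgroup_of N) : retraction (val n) = n.
Proof.
rewrite -[val n]mulg1 retractionM; apply: (mulgI n^-1%g); rewrite mulKg mulVg.
by apply: val_inj; rewrite /= mul1g mulVg.
Qed.

(** A cochain of $N$ is extended to $G$ along the $N$-equivariant [retraction]. Restricting to $N$
    and evaluating at 1 recovers it, and turns a coboundary over $G$ into one over $N$. *)
Lemma shapiro m :
  cohomology_zero (sm_type coinduced) m -> cohomology_zero M m.
Proof.
move=> H f [fP df].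
pose F (g : 'I_m.+1 -> G) : T := fun x => f (fun i => retraction (x * g i)%g).
have FS g : coinduced (F g).
  move=> n x; rewrite /F -fP; congr f; apply/funext => i.
  by rewrite -mulgA retractionM.
pose F' g := sm_of (FS g).
have F'1 (n : 'I_m.+1 -> subgroup_of N) : val (F' (val \o n)) 1%g = f n.
  by rewrite /= /F; congr f; apply/funext => i; rewrite mul1g retraction_val.
have : is_coboundary F'.
  apply: H; split=> [h g|g]; apply: val_inj.
    rewrite linearZ; apply/funext => x /=; rewrite QG_ofZ_apply /F; congr f.
    by apply/funext => i; rewrite mulgA.
  rewrite -[coboundary _ _]/(cobd F' g) linear_cobd linear0; apply/funext => x.
  rewrite cobd_apply; apply: etrans _ (df (fun i => retraction (x * g i)%g)).
  by apply: eq_bigr => i _; rewrite rat_sign.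
case: m f fP df F FS F' F'1 {H} => [|m] f fP df F FS F' F'1 /=.
  by move=> F0 n; rewrite -F'1 F0.
move=> [E EP FE]; exists (fun n => val (E (val \o n)) 1%g) => [h n|n].
  rewrite (_ : \val \o _ = fun i => (val h * val (n i))%g)//.
  rewrite EP linearZ /= QG_ofZ_apply mul1g.
  by have := sm_valP (E (\val \o n)) h 1%g; rewrite mulg1.
rewrite -F'1 FE -[coboundary _ _]/(cobd E _) linear_cobd cobd_apply /coboundary.
by apply: eq_bigr => i _; rewrite rat_sign.
Qed.

End Shapiro.

(** * Evaluating Novikov series at a function *)

Section FiniteSupportSums.
Variables (I : choiceType) (V W : zmodType).
Implicit Types F H : I -> V.

Lemma fsum_morph F (u : V -> W) : {morph u : x y / x + y} ->
  finite_set [set i | F i != 0] ->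
  u (\sum_(i \in [set: I]) F i) = \sum_(i \in [set: I]) u (F i).
Proof.
move=> uD fin; have u0 : u 0 = 0 by apply: (addrI (u 0)); rewrite -uD !addr0.
rewrite (sum_on fin)// (@sum_on _ _ (fun i => u (F i)) _ fin) => [|i].
  exact: (big_morph u uD u0).
by apply: contra_neq => ->.
Qed.

Lemma fsum_add F H : finite_set [set i | F i != 0] ->
  finite_set [set i | H i != 0] ->
  \sum_(i \in [set: I]) (F i + H i) =
  \sum_(i \in [set: I]) F i + \sum_(i \in [set: I]) H i.
Proof.
move=> finF finH; pose X := [set i | F i != 0] `|` [set i | H i != 0].
have finX : finite_set X by rewrite finite_setU.
rewrite (@sum_on _ _ F _ finX) => [|i Fi]; last by left.
rewrite (@sum_on _ _ H _ finX) => [|i Hi]; last by right.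
rewrite (@sum_on _ _ _ _ finX) ?big_split// => i.
have [->|Fi _] := eqVneq (F i) 0; last by left.
by rewrite add0r; right.
Qed.

Lemma fsum_single F i : (forall j, j != i -> F j = 0) ->
  \sum_(j \in [set: I]) F j = F i.
Proof.
move=> F0; rewrite (@sum_on _ _ _ [set i]) ?fset_set1 ?big_seq_fset1//.
by move=> j; apply: contra_neqP => /eqP/F0.
Qed.

Lemma fsum_neq0 F : \sum_(i \in [set: I]) F i != 0 -> exists i, F i != 0.
Proof.
apply: contra_neqP => F0; apply: fsbig1 => i _.
by apply: contrapT => /eqP Fi; apply: F0; exists i.
Qed.
End FiniteSupportSums.

Section Evaluation.
Variables (G : groupType) (N : normalSubgroup G).
Variable M : lmodType (QG (subgroup_of N)).
Notation T := (translation_module G (rat_module M)).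

(* [phi a] is [a * f]; the fourth clause bounds its support when [a] is       *)
(* homogeneous, which keeps the sums in the next completion step finite.      *)
Definition evaluation (Gam : groupType) (C : crossedProductOver (QG G) Gam)
    (deg : G -> Gam) (f : T) (phi : C -> T) : Prop :=
  [/\ {morph phi : a b / a + b},
      forall g r a, phi (cpo_incl C (mono g r) * a) = mono g r *: phi a,
      phi 1 = f,
      forall d a x, cp_hom C d a -> phi a x != 0 ->
        exists2 y, f y != 0 & deg x = (d * deg y)%g &
      forall a, coinduced M (phi a)].
Arguments evaluation {Gam} C deg f phi.

Section Step.
Variables (R : realType) (Gam Del : groupType) (p : Gam -> Del).
Hypothesis pM : {morph p : x y / (x * y)%g}.
Hypothesis p_surj : forall d, exists g, p g = d.
Variable K : normalSubgroup Gam.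
Hypothesis p_ker : forall g, (p g = 1%g) <-> g \in K.
Hypothesis K_central : forall x y : Gam, x \in K -> (x * y = y * x)%g.
Variable chi : subgroup_of K -> R.
Hypothesis chiM : forall x y, chi (x * y)%g = chi x + chi y.
Variable C : crossedProductOver (QG G) Gam.
Variables (gam deg : G -> Gam).
Hypothesis degM : forall x g, deg (x * g)%g = ((gam g)^-1 * deg x)%g.
Hypothesis degN : forall (n : subgroup_of N) x, deg (val n * x)%g = deg x.
Hypothesis incl_hom : forall g r, cp_hom C (gam g) (cpo_incl C (mono g r)).

Let D : crossedProductOver (QG G) Del := CrossedProductOver
  (novikov_inclusion pM p_surj p_ker K_central chiM C \o cpo_incl C).

Lemma step_incl_hom g r : cp_hom D (p (gam g)) (cpo_incl D (mono g r)).
Proof.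
move=> k; rewrite /= (cp_comp_hom (incl_hom g r)) /monomial.
by have [->|_] := eqVneq k (gam g); rewrite ?eqxx.
Qed.

(** The counterpart of the Novikov condition: on each coset of [K] the degrees of [f] are bounded
    below, with a bound that may depend on the coset. *)
Definition bounded_support (f : T) : Prop :=
  forall g : Gam, exists t, forall (k : subgroup_of K) x,
    f x != 0 -> deg x = (val k * g)%g -> t <= chi k.

Definition restrict_degree (f : T) (h : Gam) : T :=
  fun x => if deg x == h then f x else 0.

Lemma restrict_degree_coinduced f h :
  coinduced M f -> coinduced M (restrict_degree f h).
Proof.
move=> fN n x; rewrite /restrict_degree degN fN.
by case: ifP => //; rewrite scaler0.
Qed.

Variable f : T.
Hypothesis f_bounded : bounded_support f.

(** The series [a] meets finitely many cosets of [K]. Within one of them, the lower bound on the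
    degrees [h] of [f] is an upper bound on the character of $kh^{-1}$, and the Novikov condition
    leaves finitely many. *)
Lemma degree_pairs_finite (a : D) (k : Gam) : finite_set [set h |
  (exists2 y, f y != 0 & deg y = h) /\
  series_val a (k * h^-1)%g != 0].
Proof.
have /seriesP[_ [fina Na]] := valP a.
have [s sK] := choice p_surj.
(* If $kh^{-1} = l\,s(d)$, then $h = l^{-1}s(d)^{-1}k$ by centrality of [K]. So [t d], the bound on
   the coset of $s(d)^{-1}k$, gives $\chi(l) \leqslant -t(d)$. *)
have [t tP] := choice (fun d => f_bounded ((s d)^-1 * k)%g).
pose Y d := [set ((val (l : subgroup_of K) * s d)^-1 * k)%g | l in
  [set l : subgroup_of K | supp (series_val a) (val l * s d)%g /\ chi l <= - t d]].
apply: (@sub_finite_set _ _ (\bigcup_(d in p @` supp (series_val a)) Y d)); last first.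
  by apply: bigcup_finite => // d _; apply: finite_image; exact: Na.
move=> h [[y fy yh] akh]; exists (p (k * h^-1)%g); first by exists (k * h^-1)%g.
have [l El] := same_fibre pM p_ker (esym (sK (p (k * h^-1)%g))).
exists l; last by rewrite -El invgM invgK mulgVK.
split; first by rewrite /supp /= -El.
have chiV : chi l^-1%g = - chi l.
  apply/eqP; rewrite -addr_eq0 -chiM mulVg; apply/eqP.
  by apply: (addrI (chi 1%g)); rewrite -chiM mulg1 addr0.
rewrite lerNr -chiV; apply: (tP _ _ y) => //.
have lK : (val l)^-1%g \in K by apply: nsV; exact: (valP l).
by rewrite yh mulgA (K_central _ lK) -invgM -El invgM invgK mulgVK.
Qed.

Variable Phi : Gam -> C -> T.
Hypothesis PhiP : forall h, evaluation C deg (restrict_degree f h) (Phi h).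

(** The product of [a] with [f], expanded over the degrees [h] of [f]: at [x] only the component of
    [a] of degree [deg x * h^-1] can contribute. *)
Definition step_evaluation (a : D) : T := fun x =>
  \sum_(h \in [set: Gam]) Phi h (series_val a (deg x * h^-1)%g) x.

Lemma Phi0 h : Phi h 0 = 0.
Proof.
by have [PhiD _ _ _ _] := PhiP h; apply: (addrI (Phi h 0)); rewrite -PhiD !addr0.
Qed.

Lemma Phi_neq0 (a : D) x h : Phi h (series_val a (deg x * h^-1)%g) x != 0 ->
  (exists2 y, f y != 0 & deg y = h) /\ series_val a (deg x * h^-1)%g != 0.
Proof.
move=> Phi_n0; split; last first.
  by apply: contra_neq Phi_n0 => ->; rewrite Phi0.
have [_ _ _ Phi_deg _] := PhiP h.
have [y] := Phi_deg _ _ _ (series_piece a _) Phi_n0.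
rewrite /restrict_degree; have [dy fy _|_] := eqVneq (deg y) h; last by rewrite eqxx.
by exists y.
Qed.

Lemma Phi_finite (a : D) x :
  finite_set [set h | Phi h (series_val a (deg x * h^-1)%g) x != 0].
Proof. by apply: sub_finite_set (degree_pairs_finite a (deg x)) => h /Phi_neq0. Qed.

Lemma step_evaluationP : evaluation D (p \o deg) f step_evaluation.
Proof.
split=> [a b|g r a||d a x ad|a n x].
- apply/funext => x; rewrite -[RHS]/(step_evaluation a x + step_evaluation b x).
  rewrite /step_evaluation -fsum_add; [|exact: Phi_finite|exact: Phi_finite].
  by apply: eq_fsbigr => h _; have [-> _ _ _ _] := PhiP h.
- apply/funext => x; rewrite monoZ_apply /step_evaluation degM.
  rewrite (@fsum_morph _ _ _ _ (fun v : rat_module M => r *: v)) => [|u v|]; last first.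
  + by rewrite -degM; exact: Phi_finite.
  + by rewrite scalerDr.
  apply: eq_fsbigr => h _.
  rewrite /= (cp_comp_hom (incl_hom g r)) conv_monomiall.
  by have [_ -> _ _ _] := PhiP h; rewrite monoZ_apply mulgA.
- apply/funext => x; rewrite /step_evaluation (@fsum_single _ _ _ (deg x)) => [|h hx].
    rewrite series1 /monomial mulgV eqxx; have [_ _ -> _ _] := PhiP (deg x).
    by rewrite /restrict_degree eqxx.
  rewrite series1 /monomial ifN ?Phi0//; apply: contra hx => /eqP.
  by move=> /mulg1_eq/invg_inj ->.
- move=> /fsum_neq0[h /Phi_neq0[[y fy yh] axh]]; exists y => //=.
  by rewrite yh -(ad _ axh) -pM mulgVK.
- rewrite /step_evaluation degN.
  rewrite (@fsum_morph _ _ _ _ (fun v : M => QG_of n *: v)) => [|u v|]; last first.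
  + exact: Phi_finite.
  + by rewrite scalerDr.
  by apply: eq_fsbigr => h _; have [_ _ _ _ ->] := PhiP h.
Qed.
End Step.
End Evaluation.
Arguments evaluation {G N M Gam} C deg f phi.

Lemma qprojV (G : groupType) (N : normalSubgroup G) (x : G) :
  qproj N x^-1%g = (qproj N x)^-1%g.
Proof.
apply: (mulIg (qproj N x)); rewrite -qprojM !mulVg.
by apply/qproj_eq1; exact: ns1.
Qed.

(** * Evaluation through the whole tower of completions, and the sign decomposition *)

Section Tower.
Variables (G : groupType) (N : normalSubgroup G).
Variable M : lmodType (QG (subgroup_of N)).
Notation T := (translation_module G (rat_module M)).
Variables (R : realType) (n : nat) (chi : multicharacter R (quotient_by N) n).
Notation Qs := (mc_series chi).

Definition tower_proj i (g : G) : quotient_by (Qs i) := qproj (Qs i) (qproj N g).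
(* The inverse, because [g *: f] is [x |-> f (x * g)]. *)
Definition tower_deg i (x : G) := tower_proj i x^-1%g.

Lemma tower_degM i x g :
  tower_deg i (x * g)%g = ((tower_proj i g)^-1 * tower_deg i x)%g.
Proof. by rewrite /tower_deg /tower_proj invgM !qprojM !qprojV. Qed.

Lemma tower_degN i (k : subgroup_of N) x : tower_deg i (val k * x)%g = tower_deg i x.
Proof.
rewrite /tower_deg /tower_proj invgM qprojM (qproj_eq1 _ (val k)^-1%g).2 ?mulg1//.
by apply: nsV; exact: (valP k).
Qed.

Lemma quo_map_tower i g :
  quo_map (Qs i) (tower_proj i.+1 g) = tower_proj i g.
Proof. exact: (quo_map_qproj (@mc_sub _ _ _ _ chi i)). Qed.

Lemma tower_hom m i g r :
  cp_hom (novikov_tower chi m i) (tower_proj i g)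
    (cpo_incl (novikov_tower chi m i) (mono g r)).
Proof.
elim: m i g r => [|m IH] i g r.
  move=> h /= hn0.
  have -> : h = g; last by [].
  exact: (@mono_supp _ g r h hn0).
rewrite -quo_map_tower; apply: step_incl_hom; exact: IH.
Qed.

(** Induction on the number of completions, starting from the action of $\mathbb{Q}G$ on functions.
    At each step [f] is cut into its restrictions to single degrees in $Q/Q_{i+1}$; these inherit
    its bounds, have evaluations by induction, and [step_evaluationP] assembles them. *)
Lemma tower_evaluation m i (f : T) : coinduced M f ->
  (forall j, (i <= j < i + m)%N ->
    bounded_support (mc_char (m := chi) (i := j)) (tower_deg j.+1) f) ->
  exists phi, evaluation (novikov_tower chi m i) (tower_deg i) f phi.
Proof.
elim: m i f => [|m IH] i f fN f_bd.
  exists (fun a : QG G => a *: f : T); split=> [a b|g r a||d a x ad|a].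
  - exact: scalerDl.
  - by rewrite -scalerA.
  - exact: scale1r.
  - rewrite -[X in X != 0]/(\sum_(g \in [set: G]) (a : QG G) g *: f (x * g)%g).
    move=> /fsum_neq0[g agf]; exists (x * g)%g.
      by apply: contra_neq agf => ->; rewrite scaler0.
    rewrite tower_degM -(ad g) ?mulVKg//.
    by apply: contra_neq agf => ->; rewrite scale0r.
  - exact: smZ.
have [|Phi PhiP] := choice (_ : forall h, exists phi,
    evaluation (novikov_tower chi m i.+1) (tower_deg i.+1)
      (restrict_degree (tower_deg i.+1) f h) phi).
  move=> h; apply: IH; first by apply: restrict_degree_coinduced => //; exact: tower_degN.
  move=> j ij g; have [|t tP] := f_bd j _ g.
    by move: ij => /andP[/ltnW-> /=]; rewrite addSnnS.
  exists t => k x; rewrite /restrict_degree; case: ifP => [_|]; last by rewrite eqxx.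
  exact: tP.
have f_bdi : bounded_support (mc_char (m := chi) (i := i)) (tower_deg i.+1) f.
  by apply: f_bd; rewrite leqnn addnS ltnS leq_addr.
have := @step_evaluationP _ _ _ _ _ _ _ (quo_mapM (@mc_sub _ _ _ _ chi i))
  (quo_map_surj (@mc_sub _ _ _ _ chi i)) _ (quo_map_ker (@mc_sub _ _ _ _ chi i))
  (@mc_comm _ _ _ _ chi i) _ (@mc_charM _ _ _ chi i) (novikov_tower chi m i.+1)
  (tower_proj i.+1) (tower_deg i.+1) (tower_degM i.+1) (tower_degN i.+1)
  (tower_hom m i.+1) f f_bdi Phi PhiP.
rewrite (_ : _ \o tower_deg i.+1 = tower_deg i); last first.
  by apply/funext => x; exact: quo_map_tower.
by move=> H; eexists; exact: H.
Qed.

(** After choosing a section of $Q/Q_{i+1} \to Q/Q_i$, every degree has a component in the central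
    kernel, and [sigma] is the sign of the character on it. On one coset that component changes by
    translation, so fixing the sign bounds the signed character below. *)
Lemma sign_section i : exists sigma : G -> bool,
  (forall (k : subgroup_of N) x, sigma (val k * x)%g = sigma x) /\
  forall (b : bool) g, exists t,
    forall (k : subgroup_of (quo_subgroup (Qs i.+1) (Qs i))) x,
    sigma x = b -> tower_deg i.+1 x = (val k * g)%g ->
    t <= (-1) ^+ b * mc_char (m := chi) k.
Proof.
pose p := @quo_map _ (Qs i.+1) (Qs i).
have pM : {morph p : x y / (x * y)%g} := quo_mapM (@mc_sub _ _ _ _ chi i).
have p_ker := quo_map_ker (@mc_sub _ _ _ _ chi i).
have [s sK] := choice (quo_map_surj (@mc_sub _ _ _ _ chi i)).
have [kap kapE] := choice (fun q => same_fibre pM p_ker (esym (sK (p q)))).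
exists (fun x => mc_char (m := chi) (kap (tower_deg i.+1 x)) < 0).
split=> [k x|b g]; first by rewrite tower_degN.
pose c := mc_char (m := chi) (kap g).
(* The central component of [val k * g] has character [mc_char k + c]; its sign gives the bound. *)
exists (if b then c else - c) => k x + xE; rewrite {}xE.
have -> : kap (val k * g)%g = (k * kap g)%g.
  apply: val_inj; apply: (mulIg (s (p (val k * g)%g))).
  rewrite -kapE -[val (k * kap g)%g]/(val k * val (kap g))%g -mulgA.
  have -> : p (val k * g)%g = p g by apply: p_val.
  by rewrite -kapE.
rewrite mc_charM -/c; case: b; rewrite ?expr1 ?expr0 ?mulN1r ?mul1r.
  by lra.
by move=> /negbT; rewrite -leNgt; lra.
Qed.

End Tower.

(** * Acyclic covers of the coinduced module *)

Section CoinducedCovers.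
Variables (G : groupType) (N : normalSubgroup G).
Variable M : lmodType (QG (subgroup_of N)).
Variables (R : realType) (n : nat) (chi : multicharacter R (quotient_by N) n).
Notation B := (sm_type (coinduced M)).

(** The covering map is multiplication of [f] by Novikov series; it sends 1 to [f]. Additivity and
    compatibility with monomials make it $\mathbb{Q}G$-linear. *)
Lemma acyclic_cover_of_bounded d eps (f : B) :
  cohomology_zero (novikov_module (signed_multicharacter chi eps)) d ->
  (forall i, (i < n)%N ->
    bounded_support (@signed_char _ _ _ chi eps i) (tower_deg chi i.+1) (val f)) ->
  acyclic_cover d [:: f].
Proof.
move=> H f_bd.
have [j /= jn|phi [phiD phiZ phi1 _ phiN]] :=
    @tower_evaluation G N M R n (signed_multicharacter chi eps) n 0 (val f) (sm_valP f).
  exact: f_bd.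
pose psi (a : novikov_module (signed_multicharacter chi eps)) : B := sm_of (phiN a).
have psi_lin : linear psi.
  apply: QG_linear => [a b|g r a]; apply: val_inj; first exact: phiD.
  by rewrite linearZ; exact: phiZ.
exists (novikov_module (signed_multicharacter chi eps)), (linear_pack psi_lin).
split=> // x; rewrite mem_seq1 => /eqP->; exists (1 : novikov_ring _).
by apply: val_inj; exact: phi1.
Qed.

Lemma coinduced_acyclic_cover d (f : B) :
  (forall eps, cohomology_zero (novikov_module (signed_multicharacter chi eps)) d) ->
  acyclic_cover d [:: f].
Proof.
move=> H; have [sigma sigmaP] := choice (sign_section chi).
pose cell (eps : n.-tuple bool) x := [forall i : 'I_n, sigma i x == tnth eps i].
pose piece eps : translation_module G (rat_module M) :=
  fun x => if cell eps x then val f x else 0.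
have pieceN eps : coinduced M (piece eps).
  move=> k x; rewrite /piece (sm_valP f k x).
  have -> : cell eps (val k * x)%g = cell eps x.
    by apply: eq_forallb => i; rewrite (sigmaP i).1.
  by case: ifP => //; rewrite scaler0.
(* Each [x] lies in exactly one cell, the one given by its own tuple of signs. *)
have -> : f = \sum_(x <- [seq sm_of (pieceN eps) | eps <- enum {: n.-tuple bool}]) x.
  rewrite big_map big_enum; apply: val_inj; rewrite linear_sum /=.
  apply/funext => x; rewrite translation_sum.
  rewrite (bigD1 [tuple sigma i x | i < n]) //= big1 ?addr0 => [|eps epsn].
    by rewrite /piece ifT//; apply/forallP => i; rewrite tnth_mktuple.
  rewrite /piece ifN//; apply: contra epsn => /forallP epsx.
  by apply/eqP/eq_from_tnth => i; rewrite tnth_mktuple (eqP (epsx i)).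
apply: acyclic_cover_sum; apply: acyclic_cover_all => _ /mapP[eps _ ->].
apply: (acyclic_cover_of_bounded (H eps)) => i ni g.
have [t tP] := (sigmaP i).2 (nth false eps i) g.
exists t => k x /=; rewrite /piece; case: ifP => [/forallP epsx _|]; last by rewrite eqxx.
apply: tP; have := epsx (Ordinal ni); rewrite (tnth_nth false) /=.
by move/eqP.
Qed.

End CoinducedCovers.

Theorem theoremF (R : realType) (G : groupType) (d : nat)
    (hFP : type_FPQ G) (hcd : cdQ G R = (d%:R)%:E)
    (N : normalSubgroup G) (hnil : nilpotent_group (quotient_by N))
    (n : nat) (chi : multicharacter R (quotient_by N) n)
    (hvanish : forall eps : n.-tuple bool,
       cohomology_zero (novikov_module (signed_multicharacter chi eps)) d) :
  (cdQ (subgroup_of N) R < cdQ G R)%E.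
Proof.
have above m (K : lmodType (QG G)) : (d < m)%N -> cohomology_zero K m.
  move=> dm; apply: contrapT => nK.
  have : ((m%:R)%:E <= cdQ G R)%E by apply: ereal_sup_ubound; exists m => //; exists K.
  by rewrite hcd lee_fin ler_nat leqNgt dm.
(* Degree [d] uses the covers; in higher degrees every $\mathbb{Q}G$-module, in particular the
   coinduced one, has no cohomology. *)
have subgroup_vanishing m (M : lmodType (QG (subgroup_of N))) :
    (d <= m)%N -> cohomology_zero M m.
  rewrite leq_eqVlt => /orP[/eqP<-|/above dm]; apply: shapiro; last exact: dm.
  apply: vanishing_of_acyclic_covers => // [K|s]; first exact: above.
  by apply: acyclic_cover_all => f _; exact: (coinduced_acyclic_cover f hvanish).
(* For [d = 0] no degree has cohomology, and the supremum of the empty set is $-\infty$. Otherwise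
   only degrees at most [d - 1] remain. *)
rewrite hcd; move: subgroup_vanishing; clear; case: d => [|e] vanish.
  rewrite /cdQ (_ : [set _ | _ in _] = set0) ?ereal_sup0 ?ltNyr//.
  by apply/seteqP; split=> // y [m [M nM] _]; apply: nM; exact: vanish.
apply: (@le_lt_trans _ _ (e%:R)%:E); last by rewrite lte_fin ltr_nat.
apply: ge_ereal_sup => _ [m [M nM] <-]; rewrite lee_fin ler_nat leqNgt.
by apply/negP => dm; apply: nM; exact: vanish.
Qed.
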